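(* Let $p\in(2,\infty)$ and let $(\mu^*,\nu^* )\in\mathcal M^+(E)\times\mathcal M^+(V\setminus B)$ be a differentiable saddle point of the function $$\mathcal E_{p,k}(\mu,\nu)=\frac{1}{\lambda_{(\mu,\nu),k}}+\frac{p-2}{p}\sum_{(u,v)\in\tilde E}\mu_{uv}^{\frac{p}{p-2}}-\frac{p-2}{p}\sum_{u\in V\setminus B}\nu_u^{\frac{p}{p-2}} .$$ Then $\big(\lambda_{(\mu^*,\nu^* ),k}^{p/2},\,f_{(\mu^*,\nu^* ),k}\big)$ is a $p$-Laplacian eigenpair such that $$\mathcal{MI}_{f_{(\mu^*,\nu^* ),k}}(\mathcal R_p)=k-1\quad\text{and}\quad \mathcal{MI}_{f_{(\mu^*,\nu^* ),k}}(-\mathcal R_p)=N-k .$$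
   Context: $G=(V,E,\omega)$ is a finite non-oriented graph: $(u,v)\in E$ iff $(v,u)\in E$, with positive weights $\omega_{uv}=\omega_{vu}$. $B\subset V$ is a (possibly empty) subset called the boundary, $V\setminus B$ are the internal nodes and $N=|V\setminus B|$. $G$ is assumed connected, meaning that the subgraph induced by $V\setminus B$ is connected. $\tilde E\subset E$ contains exactly one orientation of each edge. $\mathcal H(V\setminus B)$ and $\mathcal H(\tilde E)$ are the spaces of real functions on $V\setminus B$ and $\tilde E$. For $f\in\mathcal H(V\setminus B)$, extended by $0$ on $B$, set $\nabla f(u,v)=\omega_{uv}(f(v)-f(u))$; $\nabla:\mathcal H(V\setminus B)\to\mathcal H(\tilde E)$ is linear with transpose $\nabla^T$. Absolute values, powers and the product $\odot$ are entrywise. $\mathcal M^+(E)$ and $\mathcal M^+(V\setminus B)$ are the sets of nonnegative functions on $\tilde E$ and on $V\setminus B$. $p$-Laplacian: $\Delta_p f=\nabla^T(|\nabla f|^{p-2}\odot\nabla f)$. A pair $(\lambda,f)$ with $f\neq0$ is a $p$-Laplacian eigenpair if $\Delta_p f(u)=\lambda|f(u)|^{p-2}f(u)$ for all $u\in V\setminus B$. $\mathcal R_p(f)=\|\nabla f\|_p^p/\|f\|_p^p$, where $\|\nabla f\|_p^p=\sum_{(u,v)\in\tilde E}|\nabla f(u,v)|^p$ and $\|f\|_p^p=\sum_{u\in V\setminus B}|f(u)|^p$. For $\mu\in\mathcal M^+(E)$, $\nu\in\mathcal M^+(V\setminus B)$ let $\Delta_\mu=\nabla^T\mathrm{diag}(\mu)\nabla$,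 $\|g\|_{2,\nu}^2=\sum_u\nu_u|g(u)|^2$, $\|H\|_{2,\mu}^2=\sum_{(u,v)\in\tilde E}\mu_{uv}|H(u,v)|^2$, $\mathcal R_{2,\mu,\nu}(g)=\|\nabla g\|_{2,\mu}^2/\|g\|_{2,\nu}^2$ (equal to $+\infty$ if only the denominator vanishes). The $(\mu,\nu)$-weighted Laplacian eigenvalue problem is $\Delta_\mu f=\lambda\,\mathrm{diag}(\nu)f$. Its well defined eigenvalues, in increasing order with values in $[0,\infty]$, are $\lambda_{(\mu,\nu),k}=\min_{A}\max_{0\ne g\in A}\mathcal R_{2,\mu,\nu}(g)$, $A$ ranging over linear subspaces of $(\ker\mathrm{diag}(\nu)\cap\ker\Delta_\mu)^\perp$ with $\dim A\ge k$. $f_{(\mu,\nu),k}$ is a corresponding eigenfunction. The multiplicity of a finite eigenvalue $\lambda$ is $\dim\{g:\Delta_\mu g=\lambda\,\mathrm{diag}(\nu)g\}$; simple means multiplicity $1$. A differentiable saddle point of $\mathcal E_{p,k}$ is a point $(\mu^*,\nu^* )$ at which $\mathcal E_{p,k}$ is differentiable and which satisfies the first-order (KKT) conditions for minimization in $\mu$ over $\mathcal M^+(E)$ and maximization in $\nu$ over $\mathcal M^+(V\setminus B)$: for every $(u,v)\in\tilde E$, $\partial_{\mu_{uv}}\mathcal E_{p,k}(\mu^*,\nu^* )\ge0$ with equality if $\mu^*_{uv}>0$; for every $u\in V\setminus B$, $\partial_{\nu_u}\mathcal E_{p,k}(\mu^*,\nu^* )\le0$ with equality if $\nu^*_u>0$.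 Differentiability at $(\mu^*,\nu^* )$ is understood as equivalent to $\lambda_{(\mu^*,\nu^* ),k}\in(0,\infty)$ being a simple eigenvalue (so that $f_{(\mu^*,\nu^* ),k}$ is unique up to scalar multiples). The Morse index $\mathcal{MI}_x(\phi)$ of a function $\phi$ at $x$ is the maximal dimension of a subspace on which the Hessian of $\phi$ at $x$ is negative definite. *)

(* Defs.v *)
From HB Require Import structures.
From mathcomp Require Import all_boot all_order all_algebra.
From mathcomp Require Import all_classical all_reals all_analysis.

Set Implicit Arguments.
Unset Strict Implicit.
Unset Printing Implicit Defensive.

Import Order.TTheory GRing.Theory Num.Theory numFieldNormedType.Exports.

Local Open Scope classical_set_scope.
Local Open Scope ring_scope.

(* Loops are not excluded; the only orientation of a loop (u, u) is (u, u)
   itself, whence the conclusion [u = v] in [orient_anti]. *)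
Record wgraph (R : realType) := WGraph {
  vertex : finType;
  edges : {set vertex * vertex};
  weight : vertex -> vertex -> R;
  boundary : {set vertex};
  orient : {set vertex * vertex};
  edges_sym : forall u v, ((u, v) \in edges) = ((v, u) \in edges);
  weight_gt0 : forall u v, (u, v) \in edges -> 0 < weight u v;
  weight_sym : forall u v, (u, v) \in edges -> weight u v = weight v u;
  orient_sub : orient \subset edges;
  orient_total : forall u v, (u, v) \in edges ->
    (u, v) \in orient \/ (v, u) \in orient;
  orient_anti : forall u v, (u, v) \in orient -> (v, u) \in orient -> u = v;
  interior_connected : forall u v, u \notin boundary -> v \notin boundary ->
    connect [rel x y | [&& x \notin boundary, y \notin boundary
                         & (x, y) \in edges]] u v
}.

Definition inode (R : realType) (G : wgraph R) : finType :=
  {u : vertex G | u \notin boundary G}.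

Definition oedge (R : realType) (G : wgraph R) : finType :=
  {e : vertex G * vertex G | e \in orient G}.

Section FiniteFunctions.
Variables (R : realType) (T : finType).
Implicit Types (x y v : {ffun T -> R}) (i j : T).

Definition dlt i : {ffun T -> R} := [ffun j => (j == i)%:R].

Definition dot x y : R := \sum_i x i * y i.

Definition diag x y : {ffun T -> R} := [ffun i => x i * y i].

Fact diag_linear x : linear (diag x).
Proof. by move=> a y z; apply/ffunP=> i; rewrite !ffunE mulrDr mulrCA. Qed.

HB.instance Definition _ x :=
  GRing.isLinear.Build R {ffun T -> R} {ffun T -> R} _ (diag x) (diag_linear x).

Definition pderiv (phi : {ffun T -> R} -> R) i x : R :=
  derive1 (fun t : R => phi (x + t *: dlt i)) 0.

Definition hessian (phi : {ffun T -> R} -> R) x i j : R :=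
  pderiv (pderiv phi j) i x.

Definition hessian_negdef (phi : {ffun T -> R} -> R) x
    (A : {vspace {ffun T -> R}}) : Prop :=
  forall v, v \in A -> v != 0 ->
    \sum_i \sum_j v i * hessian phi x i j * v j < 0.

(* The bound on [m] is harmless: subspaces have dimension at most [#|T|]. *)
Definition morse_index (phi : {ffun T -> R} -> R) x : nat :=
  \max_(m < #|T|.+1 |
        `[< exists2 A, hessian_negdef phi x A & \dim A = m :> nat >]) m.

(* Partial derivative at [x] of a function on the nonnegative orthant: the
   increments are restricted to those staying in the orthant, so that the
   derivative is two-sided when [0 < x i] and a right derivative when
   [x i = 0]. *)
Definition orthant_pderiv (phi : {ffun T -> R} -> \bar R) x i (d : R) : Prop :=
  ((phi (x + h *: dlt i)%R - phi x) * (h^-1)%:E)%E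
    @[h --> within [set h : R | 0 <= x i + h] 0^'] --> d%:E.

End FiniteFunctions.

Section Graph.
Variables (R : realType) (G : wgraph R).
Implicit Types (f g : {ffun inode G -> R}) (H mu : {ffun oedge G -> R}).
Implicit Types (nu : {ffun inode G -> R}) (p lam : R) (k : nat).

Definition ext0 f (u : vertex G) : R :=
  if insub u is Some i then f i else 0.

Definition grad f : {ffun oedge G -> R} :=
  [ffun e => weight (val e).1 (val e).2
             * (ext0 f (val e).2 - ext0 f (val e).1)].

Definition gradT H : {ffun inode G -> R} :=
  [ffun u => \sum_e grad (dlt R u) e * H e].

Fact grad_linear : linear grad.
Proof.
move=> a f g; apply/ffunP=> e; rewrite !ffunE /ext0.
have E u : ext0 (a *: f + g) u = a * ext0 f u + ext0 g u.
  by rewrite /ext0; case: insub => [i|]; rewrite ?ffunE // mulr0 addr0.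
by move: E; rewrite /ext0 => E; rewrite !E opprD addrACA -mulrBr mulrDr mulrCA.
Qed.

HB.instance Definition _ :=
  GRing.isLinear.Build R {ffun inode G -> R} {ffun oedge G -> R} _
    grad grad_linear.

Fact gradT_linear : linear gradT.
Proof.
move=> a H K; apply/ffunP=> u; rewrite !ffunE scaler_sumr -big_split /=.
by apply: eq_bigr => e _; rewrite !ffunE mulrDr mulrCA.
Qed.

HB.instance Definition _ :=
  GRing.isLinear.Build R {ffun oedge G -> R} {ffun inode G -> R} _
    gradT gradT_linear.

Definition plaplacian p f : {ffun inode G -> R} :=
  gradT [ffun e => `|grad f e| `^ (p - 2) * grad f e].

Definition plaplacian_eigenpair p lam f : Prop :=
  f != 0 /\
  forall u, plaplacian p f u = lam * (`|f u| `^ (p - 2) * f u).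

Definition prayleigh p f : R :=
  (\sum_e `|grad f e| `^ p) / (\sum_u `|f u| `^ p).

Definition wlaplacian mu : {ffun inode G -> R} -> {ffun inode G -> R} :=
  gradT \o diag mu \o grad.

HB.instance Definition _ mu := GRing.Linear.on (wlaplacian mu).

Definition weigenspace mu nu lam : {vspace {ffun inode G -> R}} :=
  lker (linfun (wlaplacian mu) - lam *: linfun (diag nu))%R.

Definition wnormsq (T : finType) (w x : {ffun T -> R}) : R :=
  \sum_i w i * `|x i| ^+ 2.

(* Only evaluated off the common kernel, where the two norms do not both
   vanish. *)
Definition wrayleigh mu nu g : \bar R :=
  if wnormsq nu g == 0 then +oo%E
  else (wnormsq mu (grad g) / wnormsq nu g)%:E.

Definition common_ker mu nu : {vspace {ffun inode G -> R}} :=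
  (lker (linfun (diag nu)) :&: lker (linfun (wlaplacian mu)))%VS.

Definition weigenvalue mu nu k : \bar R :=
  ereal_inf [set ereal_sup [set wrayleigh mu nu g |
                             g in [set g | g \in A /\ g != 0]] |
    A in [set A : {vspace {ffun inode G -> R}} |
           (k <= \dim A)%N /\
           {in A & common_ker mu nu, forall g h, dot g h = 0}]].

Definition energy p k mu nu : \bar R :=
  ((weigenvalue mu nu k)^-1
   + ((p - 2) / p * \sum_e mu e `^ (p / (p - 2)))%:E
   - ((p - 2) / p * \sum_u nu u `^ (p / (p - 2)))%:E)%E.

(* Differentiability of the energy at a point is understood as: the k-th
   eigenvalue lies in (0, +oo) and is simple. *)
Record differentiable_saddle p k mu nu : Prop := DifferentiableSaddle {
  saddle_finite : (0 < weigenvalue mu nu k < +oo)%E;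
  saddle_simple : \dim (weigenspace mu nu (fine (weigenvalue mu nu k))) = 1%N;
  saddle_mu : forall e, exists d : R,
    [/\ orthant_pderiv (fun m => energy p k m nu) mu e d,
        0 <= d & 0 < mu e -> d = 0];
  saddle_nu : forall u, exists d : R,
    [/\ orthant_pderiv (fun n => energy p k mu n) nu u d,
        d <= 0 & 0 < nu u -> d = 0]
}.

End Graph.

(* Main.v *)
Require Import Defs.
From HB Require Import structures.
From mathcomp Require Import all_boot all_order all_algebra.
From mathcomp Require Import all_classical all_reals all_analysis.
From mathcomp Require Import lra ring zify.
Import Order.TTheory GRing.Theory Num.Theory numFieldNormedType.Exports.
Local Open Scope ring_scope.

Set Implicit Arguments.
Unset Strict Implicit.
Unset Printing Implicit Defensive.

(** Let [lam] be the k-th eigenvalue, [K] and [M] the quadratic forms of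
    [wlaplacian mu] and [diag nu], and [Q] the form [K - lam * M] ([pencil]), whose
    radical is the line of [f]. Everything is read off from [mu], [nu] and [Q].

    The saddle conditions say that [mu e] is proportional to
    [`|grad f e| `^ (p - 2)] and [nu u] to [`|f u| `^ (p - 2)]: along a coordinate
    of [mu], the derivative of [lam^-1] is [- grad f e ^+ 2 / (lam * K f f)] and
    that of the penalty is [mu e `^ (2 / (p - 2))], and likewise for [nu]. For
    such weights the weighted eigenvalue equation of [f] is the p-Laplacian
    equation with eigenvalue [lam `^ (p / 2)]. Moreover [f] is then a critical
    point of the p-Rayleigh quotient, and the Hessian there is a positive multiple
    of [Q] ([matching_hessian]), because the second derivative of a sum of p-th
    powers is the weighted sum of squares with weights
    [p * (p - 1) * `|_| `^ (p - 2)].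
    So the two Morse indices are the numbers of negative and of positive squares
    of [Q].

    These numbers are read off the min-max value ([simple_eigenvalue_index]). A
    subspace of dimension [k] on which [Q] is negative would push the min-max
    value below [lam]; a positive subspace of dimension [#|inode G| - k + 1] would
    meet every competitor and push it above. As the radical of [Q] is a line,
    [Q] has [k - 1] negative and [#|inode G| - k] positive squares. The count also
    excludes a common kernel of [K] and [M].

    The saddle conditions provide the partial derivatives of the energy, and a
    one-sided estimate of [lam^-1] to first order is enough to pin them down at an
    interior coordinate and to bound them on the useful side at a vanishing one
    ([orthant_pderiv_upper]). Such an estimate is again a min-max comparison, with
    the positive (for [mu]) or the negative (for [nu]) subspace of [Q] enlarged by
    [f]; on this space the perturbed form is definite for small increments as soon
    as its first-order term is positive at [f] ([finsler]). *)

(** * Symmetric bilinear forms *)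

Definition symform (F : realFieldType) (V : vectType F) (B : V -> V -> F) :=
  (forall x y, B x y = B y x) /\
  (forall a x y z, B (a *: x + y) z = a * B x z + B y z).

Section SymForm.
Variables (F : realFieldType) (V : vectType F) (B : V -> V -> F).
Hypothesis hB : symform B.

Lemma symformC x y : B x y = B y x. Proof. exact: hB.1. Qed.

Lemma symform0l z : B 0 z = 0.
Proof.
have := hB.2 1 0 0 z; rewrite scaler0 add0r mul1r => /(congr1 (+%R^~ (- B 0 z))).
by rewrite addrK subrr.
Qed.

Lemma symformZl a x z : B (a *: x) z = a * B x z.
Proof. by have := hB.2 a x 0 z; rewrite addr0 symform0l addr0. Qed.

Lemma symformDl x y z : B (x + y) z = B x z + B y z.
Proof. by have := hB.2 1 x y z; rewrite scale1r mul1r. Qed.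

Lemma symform0r z : B z 0 = 0. Proof. by rewrite symformC symform0l. Qed.

Lemma symformZr a x z : B z (a *: x) = a * B z x.
Proof. by rewrite symformC symformZl symformC. Qed.

Lemma symformDr x y z : B z (x + y) = B z x + B z y.
Proof. by rewrite symformC symformDl !(symformC z). Qed.

Lemma symform_suml I (r : seq I) (c : I -> F) (E : I -> V) z :
  B (\sum_(i <- r) c i *: E i) z = \sum_(i <- r) c i * B (E i) z.
Proof.
elim: r => [|i r IH]; first by rewrite !big_nil symform0l.
by rewrite !big_cons symformDl symformZl IH.
Qed.

Lemma symform_sumr I (r : seq I) (c : I -> F) (E : I -> V) z :
  B z (\sum_(i <- r) c i *: E i) = \sum_(i <- r) c i * B z (E i).
Proof.
by rewrite symformC symform_suml; apply: eq_bigr => i _; rewrite symformC.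
Qed.

(** Polarization. *)
Lemma symform_radical0 (U : {vspace V}) :
  (forall x, x \in U -> B x x = 0) -> {in U &, forall x y, B x y = 0}.
Proof.
move=> h x y xU yU; have := h _ (memvD xU yU).
rewrite symformDl !symformDr (h x xU) (h y yU) (symformC y x) add0r addr0.
by move/eqP; rewrite -mulr2n mulrn_eq0 /= => /eqP.
Qed.

End SymForm.

Lemma symform_lin (F : realFieldType) (V : vectType F) (A B : V -> V -> F) a b :
  symform A -> symform B -> symform (fun x y => a * A x y + b * B x y).
Proof.
move=> hA hB; split=> [x y|c x y z]; first by rewrite (hA.1 x) (hB.1 x).
by rewrite hA.2 hB.2; ring.
Qed.

Lemma symform_opp (F : realFieldType) (V : vectType F) (B : V -> V -> F) :
  symform B -> symform (fun x y => - B x y).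
Proof.
by move=> hB; split=> [x y|a x y z]; [rewrite hB.1|rewrite hB.2 opprD mulrN].
Qed.

(** The orthogonal subspace is the kernel of the map that sends a vector to its
    products with a basis of [W], which gives the dimension bound even for a
    degenerate form. *)
Lemma orthogonal_subspace (F : realFieldType) (V : vectType F)
    (B : V -> V -> F) (W : {vspace V}) : symform B ->
  exists W' : {vspace V},
    (forall x, x \in W' <-> {in W, forall w, B x w = 0}) /\
    (\dim {:V} <= \dim W + \dim W')%N.
Proof.
move=> hB; pose b : (\dim W).-tuple V := vbasis W.
(* The codomain is [F^o] so that it carries a vector space structure. *)
pose coords x : {ffun 'I_(\dim W) -> F^o} := [ffun i => B x (tnth b i)].
have lin_coords : linear coords.
  by move=> a x y; apply/ffunP=> i; rewrite !ffunE hB.2.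
pose L : {linear V -> {ffun 'I_(\dim W) -> F^o}} :=
  HB.pack_for {linear V -> {ffun 'I_(\dim W) -> F^o}} coords
   (GRing.isLinear.Build F V {ffun 'I_(\dim W) -> F^o} _ coords lin_coords).
exists (lker (linfun L)); split=> [x|].
  rewrite memv_ker lfunE /=; split=> [/eqP x0 w wW|xW].
    rewrite (coord_vbasis wW) (symform_sumr hB) big1 // => i _.
    move/ffunP/(_ i): x0; rewrite !ffunE -/b (tnth_nth 0) => ->.
    by rewrite mulr0.
  by apply/eqP/ffunP=> i; rewrite !ffunE xW // vbasis_mem ?mem_tnth.
have := limg_ker_dim (linfun L) fullv; rewrite capfv => <-.
rewrite addnC leq_add2r (leq_trans (dimvS (subvf _))) //.
by rewrite dimvf /= /dim /= card_ord muln1.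
Qed.

(** Split off a vector that is not isotropic and recurse in its orthogonal; when
    every vector of [U] is isotropic, the form vanishes on [U] and any basis will
    do. *)
Lemma orthogonal_basis (F : realFieldType) (V : vectType F)
    (B : V -> V -> F) (U : {vspace V}) : symform B ->
  exists2 X : seq V, basis_of U X &
    {in X &, forall x y, x != y -> B x y = 0}.
Proof.
move=> hB; elim: {U}_.+1 {-2}U (ltnSn (\dim U)) => // n IH U; rewrite ltnS => leUn.
have [U0|] := pselect (forall x, x \in U -> B x x = 0).
  exists (vbasis U); first exact: vbasisP.
  by move=> x y xX yX _; rewrite (symform_radical0 hB U0) ?vbasis_mem.
move=> /existsNP[v /not_implyP[vU /eqP Bvv]].
have [v' [v'P _]] := orthogonal_subspace <[v]> hB.
have v'E x : x \in v' <-> B x v = 0.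
  rewrite v'P; split=> [-> //|xv w /vlineP[c ->]]; first exact: memv_line.
  by rewrite (symformZr hB) xv mulr0.
have vNv' : v \notin v' by apply: contraNN Bvv => /v'E ->.
have sU'U : (U :&: v' <= U)%VS by exact: capvSl.
have ltU' : (\dim (U :&: v') < n)%N.
  apply: leq_trans leUn; rewrite ltnNge; apply: contra vNv' => leU.
  have /eqP UE : (U :&: v' == U)%VS by rewrite eqEdim sU'U.
  by move: vU; rewrite -{1}UE memv_cap => /andP[].
have [X' X'b X'o] := IH _ ltU'.
exists (v :: X').
  rewrite /basis_of span_cons (span_basis X'b) free_cons (basis_free X'b).
  rewrite (span_basis X'b) memv_cap negb_and vNv' orbT andbT.
  rewrite eqEsubv subv_add sU'U andbT -memvE vU /=.
  apply/subvP=> x xU; rewrite -(subrK (B x v / B v v *: v) x) addrC.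
  apply: memv_add; first by rewrite memvZ ?memv_line.
  rewrite memv_cap rpredB ?memvZ //=; apply/v'E.
  rewrite (symformDl hB) -scaleNr (symformZl hB) mulNr mulfVK ?subrr //.
have X'v x : x \in X' -> B x v = 0.
  by move=> /(basis_mem X'b); rewrite memv_cap => /andP[_ /v'E].
move=> x y; rewrite !inE => /predU1P[->|xX'] /predU1P[->|yX'].
- by rewrite eqxx.
- by rewrite (symformC hB) X'v.
- by rewrite X'v.
- exact: X'o.
Qed.

Definition posdef (F : realFieldType) (V : vectType F) (B : V -> V -> F)
  (U : {vspace V}) := forall x, x \in U -> x != 0 -> 0 < B x x.

Section OrthogonalExpansion.
Variables (F : realFieldType) (V : vectType F) (B : V -> V -> F).
Hypothesis hB : symform B.
Variables (n : nat) (X : n.-tuple V).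
Hypothesis Xo : {in X &, forall x y, x != y -> B x y = 0}.
Hypothesis Xfree : free X.

Lemma orthogonal_tnth (i j : 'I_n) : i != j -> B X`_i X`_j = 0.
Proof.
move=> neij; apply: Xo; rewrite ?mem_nth ?size_tuple //.
by rewrite nth_uniq ?size_tuple ?free_uniq.
Qed.

Lemma orthogonal_expand x y : x \in <<X>>%VS -> y \in <<X>>%VS ->
  B x y = \sum_(i < n) coord X i x * coord X i y * B X`_i X`_i.
Proof.
move=> /coord_span {1}-> /coord_span {1}->.
rewrite (symform_suml hB); apply: eq_bigr => i _.
rewrite (symform_sumr hB) (bigD1 i) //= big1 ?addr0 ?mulrA // => j neji.
by rewrite orthogonal_tnth ?mulr0 // eq_sym.
Qed.

Lemma coord_neq0 x : x \in <<X>>%VS -> x != 0 -> exists i, coord X i x != 0.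
Proof.
move=> xX x0; apply/existsP; apply: contraNT x0.
rewrite negb_exists => /forallP x0; rewrite (coord_span xX) big1 // => i _.
by move: (x0 i); rewrite negbK => /eqP ->; rewrite scale0r.
Qed.

Lemma posdef_span : (forall x, x \in X -> 0 < B x x) -> posdef B <<X>>.
Proof.
move=> Xpos x xX x0; rewrite orthogonal_expand //.
have [i ci] := coord_neq0 xX x0.
have Bpos (j : 'I_n) : 0 < B X`_j X`_j by rewrite Xpos ?mem_nth ?size_tuple.
rewrite (bigD1 i) //=; apply: ltr_pwDl.
  by rewrite -expr2 mulr_gt0 // exprn_even_gt0.
by apply: sumr_ge0 => j _; rewrite -expr2 mulr_ge0 ?sqr_ge0 // ltW.
Qed.

End OrthogonalExpansion.

(** Sylvester's law of inertia, existence part: the vectors of an orthogonal basis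
    are sorted by the sign of their square. *)
Lemma sylvester (F : realFieldType) (V : vectType F) (B : V -> V -> F) :
  symform B ->
  exists N Z P : {vspace V},
    [/\ (\dim N + \dim Z + \dim P)%N = \dim {:V},
        posdef (fun x y => - B x y) N, posdef B P &
        forall x, x \in Z <-> forall y, B x y = 0].
Proof.
move=> hB; have [X Xb Xo] := orthogonal_basis fullv hB.
have Xfree := basis_free Xb.
pose part s := [seq x <- X | Num.sg (B x x) == s].
have dim_part s : \dim <<part s>> = count (fun x => Num.sg (B x x) == s) X.
  by rewrite -size_filter; apply/eqP; apply: filter_free.
have part_o s : {in part s &, forall x y, x != y -> B x y = 0}.
  by move=> x y; rewrite !mem_filter => /andP[_ xX] /andP[_ yX]; apply: Xo.
have part_sg s x : x \in part s -> Num.sg (B x x) = s.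
  by rewrite mem_filter => /andP[/eqP].
pose Xn := part (-1); pose Xz := part 0; pose Xp := part 1.
exists <<Xn>>%VS, <<Xz>>%VS, <<Xp>>%VS; split.
- rewrite !dim_part -(span_basis Xb) (eqP Xfree).
  elim: (X) => //= x X' <-.
  case: sgrP => _; rewrite ?eqxx ?oppr_eq0 ?oner_eq0 ?(eq_sym 0) ?(eq_sym _ (-1)) /=.
  + by rewrite oppr_eq0 oner_eq0; lia.
  + by rewrite eqNr oner_eq0; lia.
  + by rewrite eqNr oner_eq0; lia.
- apply: (@posdef_span _ _ _ (symform_opp hB) _ (in_tuple (part (-1)))) => /=.
  + by move=> x y xX yX nexy; rewrite (part_o _ _ _ xX yX) ?oppr0.
  + exact: filter_free.
  + by move=> x /part_sg/eqP; rewrite sgr_cp0 oppr_gt0.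
- apply: (@posdef_span _ _ _ hB _ (in_tuple (part 1))) => /=.
  + exact: part_o.
  + exact: filter_free.
  + by move=> x /part_sg/eqP; rewrite sgr_cp0.
pose Xt := in_tuple X.
have XV y : y \in <<X>>%VS by rewrite (span_basis Xb) memvf.
have XtX (i : 'I_(size X)) : Xt`_i \in X by rewrite mem_nth ?size_tuple.
move=> x; split=> [xZ y|xrad].
  rewrite (coord_span (X := in_tuple (part 0)) xZ).
  rewrite (symform_suml hB) big1 // => i _.
  set z := _`_i; have zP : z \in part 0 by rewrite mem_nth ?size_tuple.
  rewrite (coord_span (X := Xt) (XV y)) (symform_sumr hB) big1 ?mulr0 // => j _.
  have [<-|neq] := eqVneq z Xt`_j.
    by move/part_sg/eqP: zP; rewrite sgr_eq0 => /eqP->; rewrite mulr0.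
  by rewrite Xo ?mulr0 //; move: zP; rewrite mem_filter => /andP[].
rewrite (coord_span (X := Xt) (XV x)); apply: memv_suml => i _.
have [Bi|Bi] := eqVneq (B Xt`_i Xt`_i) 0.
  by rewrite memvZ // memv_span // mem_filter Bi sgr0 eqxx XtX.
suff /eqP : coord Xt i x * B Xt`_i Xt`_i = 0.
  by rewrite mulf_eq0 (negPf Bi) orbF => /eqP->; rewrite scale0r mem0v.
rewrite -(xrad Xt`_i) {2}(coord_span (X := Xt) (XV x)) (symform_suml hB).
rewrite (bigD1 i) //= big1 ?addr0 // => j neji.
by rewrite (orthogonal_tnth (X := Xt)) ?mulr0.
Qed.

(** * Definite forms and their perturbation *)

Lemma posdef_disjoint (F : realFieldType) (V : vectType F) (B : V -> V -> F)
    (P Z : {vspace V}) :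
  posdef B P -> {in Z, forall z, B z z <= 0} -> (P :&: Z = 0)%VS.
Proof.
move=> Bpos Bnpos; apply/eqP; rewrite -subv0; apply/subvP => x.
rewrite memv_cap memv0 => /andP[xP xZ].
by apply: contraTT (Bnpos x xZ) => x0; rewrite -ltNge Bpos.
Qed.

Lemma posdef_dim_sum (F : realFieldType) (V : vectType F) (B : V -> V -> F)
    (P Z : {vspace V}) :
  posdef B P -> {in Z, forall z, B z z <= 0} ->
  \dim (P + Z) = (\dim P + \dim Z)%N.
Proof. by move=> hP hZ; exact: dimv_disjoint_sum (posdef_disjoint hP hZ). Qed.

(** The dimension count behind every min-max argument below. *)
Lemma exists_nonzero_cap (F : fieldType) (V : vectType F) (A X : {vspace V}) :
  (\dim {:V} < \dim A + \dim X)%N -> exists2 g, g \in (A :&: X)%VS & g != 0.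
Proof.
move=> ltn; exists (vpick (A :&: X)); first exact: memv_pick.
rewrite vpick0 -dimv_eq0 -lt0n.
by have := dimv_sum_cap A X; have := dimvS (subvf (A + X)); lia.
Qed.

(** In an orthogonal basis each squared coordinate of [x] is at most a constant
    times [B x x], so every coefficient of [T] can be absorbed. This replaces the
    compactness of the unit sphere. *)
Lemma posdef_dominates (F : realFieldType) (V : vectType F)
    (B T : V -> V -> F) (P : {vspace V}) :
  symform B -> symform T -> posdef B P ->
  exists2 C, 0 < C & {in P, forall x, `|T x x| <= C * B x x}.
Proof.
move=> hB hT Bpos; have [X0 Xb Xo] := orthogonal_basis P hB.
pose X := in_tuple X0; have Xfree : free X by exact: basis_free Xb.
have XP : <<X>>%VS = P by exact: span_basis.
pose b (i : 'I_(size X0)) := B X`_i X`_i.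
have b_gt0 i : 0 < b i.
  by rewrite Bpos ?(basis_mem Xb) ?(basis_not0 Xb) ?mem_nth.
pose t (i j : 'I_(size X0)) := `|T X`_i X`_j| * ((b i)^-1 + (b j)^-1).
have t_ge0 i j : 0 <= t i j.
  by rewrite mulr_ge0 ?addr_ge0 // invr_ge0 ltW.
exists (1 + \sum_i \sum_j t i j) => [|x].
  by apply: ltr_pwDl => //; do 2!apply: sumr_ge0 => ? _.
rewrite -{1}XP => xX; have BxE := orthogonal_expand (X := X) hB Xo Xfree xX xX.
have Bx_ge0 : 0 <= B x x.
  rewrite BxE; apply: sumr_ge0 => i _.
  by rewrite -expr2 mulr_ge0 ?sqr_ge0 // ltW ?b_gt0.
have c2 i : coord X i x ^+ 2 <= (b i)^-1 * B x x.
  rewrite ler_pdivlMl ?b_gt0 // BxE (bigD1 i) //= -expr2 mulrC lerDl.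
  by apply: sumr_ge0 => j _; rewrite -expr2 mulr_ge0 ?sqr_ge0 // ltW ?b_gt0.
rewrite {1 2}(coord_span xX) (symform_suml hT) mulrDl mul1r.
apply: le_trans (ler_norm_sum _ _ _) _; rewrite -[leLHS]add0r.
apply: lerD => //; rewrite mulr_suml; apply: ler_sum => i _.
rewrite (symform_sumr hT) mulr_sumr mulr_suml.
apply: le_trans (ler_norm_sum _ _ _) _; apply: ler_sum => j _.
rewrite /t mulrA !normrM mulrC -mulrA ler_wpM2l // mulrDl.
apply: le_trans (lerD (c2 i) (c2 j)).
rewrite -(real_normK (num_real (coord X i x))) -(real_normK (num_real (coord X j x))).
set u := `|_|; set v := `|_|.
by have := sqr_ge0 (u - v); have := sqr_ge0 (u + v); nra.
Qed.

Lemma posdef_add_radical (F : realFieldType) (V : vectType F)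
    (B : V -> V -> F) (U : {vspace V}) (f : V) :
  symform B -> posdef B U -> (forall y, B f y = 0) ->
  {in (U + <[f]>)%VS, forall x, 0 <= B x x}.
Proof.
move=> hB Upos f_rad _ /memv_addP[x xU [_ /vlineP[c ->] ->]].
rewrite (symformDl hB) (symformZl hB) f_rad mulr0 addr0 (symformDr hB).
rewrite (symformZr hB) (symformC hB x f) f_rad mulr0 addr0.
have [->|x0] := eqVneq x 0; first by rewrite (symform0l hB).
by rewrite ltW ?Upos.
Qed.

Lemma posdef_dim_line (F : realFieldType) (V : vectType F)
    (B : V -> V -> F) (U : {vspace V}) (f : V) :
  symform B -> posdef B U -> (forall y, B f y = 0) -> f != 0 ->
  \dim (U + <[f]>) = (\dim U + 1)%N.
Proof.
move=> hB Upos f_rad f0; rewrite (posdef_dim_sum Upos) ?dim_vline ?f0 //.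
by move=> _ /vlineP[c ->]; rewrite (symformZl hB) f_rad mulr0.
Qed.

(** Debreu's form of Finsler's lemma, with a kernel of dimension one. Completing
    the square in the direction of [f] turns [T] into [T f f] times a square plus a
    form [T'] of the component in [P] alone; there [t * T'] is dominated by [B]
    once [t] is small. *)
Lemma finsler (F : realFieldType) (V : vectType F)
    (B T : V -> V -> F) (P : {vspace V}) (f : V) :
  symform B -> symform T -> posdef B P -> (forall y, B f y = 0) ->
  0 < T f f ->
  exists2 t0, 0 < t0 & forall t, 0 < t < t0 ->
    posdef (fun x y => B x y + t * T x y) (P + <[f]>).
Proof.
move=> hB hT Bpos Bf Tf.
(* [T'] is the form [T] minimized over the line [x + s *: f]. *)
pose S x y := T f x * T f y.
have hS : symform S.
  split=> [x y|a x y z]; first by rewrite /S mulrC.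
  by rewrite /S (symformDr hT) (symformZr hT); ring.
pose T' x y := 1 * T x y + (- (T f f)^-1) * S x y.
have hT' : symform T' by exact: symform_lin.
have [C C0 CP] := posdef_dominates hB hT' Bpos.
exists C^-1 => [|t /andP[t0 tC]]; first by rewrite invr_gt0.
move=> g /memv_addP[x xP [y /vlineP[s ->] ->]] g0.
have BE : B (x + s *: f) (x + s *: f) = B x x.
  by rewrite (symformDl hB) (symformZl hB) Bf (symformDr hB) (symformZr hB)
    (symformC hB x f) Bf; ring.
have TE : T (x + s *: f) (x + s *: f) =
    T f f * (s + (T f f)^-1 * T f x) ^+ 2 + T' x x.
  rewrite !(symformDl hT, symformZl hT, symformDr hT, symformZr hT).
  by rewrite (symformC hT x f) /T' /S; field; rewrite gt_eqF.
rewrite BE TE; have [x0|x0] := eqVneq x 0.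
  have T'0 : T' x x = 0 by rewrite x0 (symform0l hT').
  rewrite T'0 x0 (symform0l hB) (symform0r hT) mulr0 !addr0 add0r.
  apply: mulr_gt0 => //; apply: mulr_gt0 => //.
  rewrite lt_neqAle eq_sym sqrf_eq0 sqr_ge0 andbT.
  by apply: contraNneq g0 => ->; rewrite x0 scale0r addr0.
have Bx := Bpos x xP x0.
have tC1 : t * C < 1 by rewrite -ltr_pdivlMr // mul1r.
have := CP x xP; rewrite ler_norml => /andP[T'x _].
have Q0 : 0 <= T f f * (s + (T f f)^-1 * T f x) ^+ 2.
  by rewrite mulr_ge0 ?sqr_ge0 // ltW.
have : 0 < (1 - t * C) * B x x by rewrite mulr_gt0 ?subr_gt0.
have := mulr_ge0 (ltW t0) Q0.
have : 0 <= t * (T' x x + C * B x x) by rewrite mulr_ge0 ?(ltW t0) //; lra.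
lra.
Qed.

(** * The min-max eigenvalue of a weighted graph *)

(** Both the Dirichlet form of the graph ([L] the gradient) and the mass form ([L]
    the identity) have this shape. *)
Definition wform (R : realType) (V : Type) (S : finType)
    (w : {ffun S -> R}) (L : V -> {ffun S -> R}) (x y : V) : R :=
  \sum_s w s * (L x s * L y s).

Lemma symform_wform (R : realType) (V : vectType R) (S : finType)
    (w : {ffun S -> R}) (L : V -> {ffun S -> R}) :
  linear L -> symform (wform w L).
Proof.
move=> hL; split=> [x y|a x y z].
  by apply: eq_bigr => s _; rewrite (mulrC (L x s)).
rewrite /wform mulr_sumr -big_split /=; apply: eq_bigr => s _.
by rewrite hL !ffunE /GRing.scale /=; ring.
Qed.

Lemma wform_ge0 (R : realType) (V : Type) (S : finType)
    (w : {ffun S -> R}) (L : V -> {ffun S -> R}) (x : V) :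
  (forall s, 0 <= w s) -> 0 <= wform w L x x.
Proof. by move=> w0; apply: sumr_ge0 => s _; rewrite mulr_ge0 // -expr2 sqr_ge0. Qed.

(** Weighted forms are affine in each weight; this is what makes the pencil
    explicit along a coordinate line of [mu] or [nu]. *)
Lemma wform_dlt (R : realType) (V : Type) (S : finType)
    (w : {ffun S -> R}) (L : V -> {ffun S -> R}) (s : S) (h : R) (x y : V) :
  wform (w + h *: dlt R s) L x y = wform w L x y + h * (L x s * L y s).
Proof.
rewrite /wform (bigD1 s) //= [in RHS](bigD1 s) //= !ffunE eqxx /GRing.scale /= mulr1.
rewrite [X in _ + X = _](eq_bigr (fun i => w i * (L x i * L y i))); last first.
  by move=> i /negPf nei; rewrite !ffunE nei /GRing.scale /= mulr0 addr0.
by rewrite mulrDl addrAC.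
Qed.

Lemma wnormsq_wform (R : realType) (V : Type) (S : finType)
    (w : {ffun S -> R}) (L : V -> {ffun S -> R}) (x : V) :
  wnormsq w (L x) = wform w L x x.
Proof. by apply: eq_bigr => s _; rewrite real_normK ?num_real // expr2. Qed.

Lemma dim_ffun_fullv (R : realType) (T : finType) :
  \dim {:{ffun T -> R}} = #|T|.
Proof. by rewrite dimvf /dim /= muln1. Qed.

Lemma ffun_dlt_sum (R : realType) (T : finType) (x : {ffun T -> R}) :
  x = \sum_u x u *: dlt R u.
Proof.
apply/ffunP=> v; rewrite sum_ffunE (bigD1 v) //= big1 => [|i /negPf nei].
  by rewrite !ffunE eqxx addr0 /GRing.scale /= mulr1.
by rewrite !ffunE eq_sym nei /GRing.scale /= mulr0.
Qed.

Section GraphForms.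
Variables (R : realType) (G : wgraph R).
Implicit Types (x y g f : {ffun inode G -> R}).
Implicit Types (mu : {ffun oedge G -> R}) (nu : {ffun inode G -> R}).
Implicit Types (X A : {vspace {ffun inode G -> R}}).

Definition kform mu x y : R := wform mu (@grad R G) x y.
Definition mform nu x y : R := wform nu id x y.

Lemma symform_kform mu : symform (kform mu).
Proof. exact/symform_wform/grad_linear. Qed.

Lemma symform_mform nu : symform (mform nu).
Proof. exact: symform_wform. Qed.

Lemma symform_dot : symform (@dot R (inode G)).
Proof.
split=> [x y|a x y z]; first by apply: eq_bigr => u _; rewrite mulrC.
rewrite /dot mulr_sumr -big_split /=; apply: eq_bigr => u _.
by rewrite !ffunE mulrDl mulrA.
Qed.

Lemma dot_gradT y (H : {ffun oedge G -> R}) :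
  dot y (gradT H) = \sum_e grad y e * H e.
Proof.
rewrite /dot; under eq_bigr => u _ do rewrite ffunE mulr_sumr.
rewrite exchange_big /=; apply: eq_bigr => e _.
rewrite {2}(ffun_dlt_sum y) linear_sum sum_ffunE mulr_suml.
by apply: eq_bigr => u _; rewrite linearZ !ffunE /GRing.scale /= !mulrA.
Qed.

Lemma dot_eq0 x : (forall y, dot y x = 0) -> x = 0.
Proof.
move=> x0; apply/ffunP=> u; have := x0 (dlt R u).
rewrite /dot (bigD1 u) //= big1 => [|v /negPf nev]; last first.
  by rewrite ffunE nev mul0r.
by rewrite !ffunE eqxx mul1r addr0.
Qed.

Lemma dot_wlaplacian mu x y : dot y (wlaplacian mu x) = kform mu x y.
Proof.
rewrite /wlaplacian /= dot_gradT; apply: eq_bigr => e _.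
by rewrite [diag _ _ _]ffunE mulrC mulrA.
Qed.

Lemma dot_diag nu x y : dot y (diag nu x) = mform nu x y.
Proof. by apply: eq_bigr => u _; rewrite ffunE mulrC mulrA. Qed.

Lemma weigenspaceP mu nu lam x :
  x \in weigenspace mu nu lam <->
  forall y, kform mu x y - lam * mform nu x y = 0.
Proof.
rewrite memv_ker add_lfunE opp_lfunE scale_lfunE !lfunE.
split=> [/eqP x0 y|x0].
  rewrite -dot_wlaplacian -dot_diag -mulNr -(symformZr symform_dot).
  by rewrite -(symformDr symform_dot) scaleNr x0 (symform0r symform_dot).
apply/eqP/dot_eq0 => y; rewrite (symformDr symform_dot) -scaleNr.
rewrite (symformZr symform_dot).
by rewrite mulNr dot_wlaplacian dot_diag.
Qed.

Lemma common_kerP mu nu x :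
  x \in common_ker mu nu <->
  (forall y, mform nu x y = 0) /\ (forall y, kform mu x y = 0).
Proof.
rewrite memv_cap !memv_ker !lfunE; split=> [/andP[/eqP m0 /eqP k0]|[m0 k0]].
  split=> y; rewrite -?dot_diag -?dot_wlaplacian ?m0 ?k0.
    by rewrite (symform0r symform_dot).
  by rewrite (symform0r symform_dot).
by apply/andP; split; apply/eqP/dot_eq0 => y; rewrite ?dot_diag ?dot_wlaplacian.
Qed.


(** Hence a subspace that satisfies a strict comparison of [kform] and [mform] may
    be enlarged by the common kernel, or projected off it. *)
Lemma wrayleighD mu nu x w : w \in common_ker mu nu ->
  wrayleigh mu nu (x + w) = wrayleigh mu nu x.
Proof.
move=> /common_kerP[m0 k0]; rewrite /wrayleigh.
have -> : wnormsq nu (x + w) = wnormsq nu x.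
  rewrite !(wnormsq_wform nu id); have hM := symform_mform nu.
  rewrite -/(mform nu _ _) (symformDl hM) m0 addr0 (symformDr hM).
  by rewrite (symformC hM x w) m0 addr0.
rewrite !(wnormsq_wform mu (@grad R G)); have hK := symform_kform mu.
rewrite -/(kform mu _ _) (symformDl hK) k0 addr0 (symformDr hK).
by rewrite (symformC hK x w) k0 addr0.
Qed.

Lemma dot_self_eq0 x : dot x x = 0 -> x = 0.
Proof.
move=> x0; apply/ffunP=> u; rewrite ffunE; apply/eqP.
rewrite -sqrf_eq0 expr2; move/eqP: x0; rewrite psumr_eq0 => [|v _].
  by move/allP/(_ u (mem_index_enum u)).
by rewrite -expr2 sqr_ge0.
Qed.

(** [X] plus the common kernel meets every competitor [A]; the point of
    intersection is not in the common kernel, to which [A] is orthogonal, so its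
    quotient is that of a nonzero vector of [X]. *)
Lemma weigenvalue_ge mu nu k kap X : (forall u, 0 <= nu u) -> 0 < kap ->
  (#|inode G| < k + \dim X + \dim (common_ker mu nu))%N ->
  posdef (fun x y => kap * kform mu x y - mform nu x y) X ->
  (kap^-1%:E <= weigenvalue mu nu k)%E.
Proof.
move=> hnu kap0 ltdim Xpos; apply: le_ereal_inf_tmp => _ [A [kA Aorth] <-].
set W := common_ker mu nu in ltdim Aorth.
have dimXW : \dim (X + W) = (\dim X + \dim W)%N.
  apply: (posdef_dim_sum Xpos) => w /common_kerP[m0 k0].
  by rewrite m0 k0 mulr0 subr0.
have [g /memv_capP[gA gXW] g0] : exists2 g, g \in (A :&: (X + W))%VS & g != 0.
  by apply: exists_nonzero_cap; rewrite dim_ffun_fullv dimXW; lia.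
have /memv_addP[x xX [w wW gE]] := gXW.
have x0 : x != 0.
  apply: contraNneq g0 => x0; apply/eqP/dot_self_eq0.
  by rewrite Aorth // gE x0 add0r.
apply: le_ereal_sup_tmp; exists (wrayleigh mu nu g); first by exists g.
rewrite gE wrayleighD // /wrayleigh; case: eqP => [_|/eqP M0].
  by rewrite leey.
have := Xpos x xX x0; rewrite lee_fin /kform -(wnormsq_wform mu (@grad R G)).
rewrite subr_gt0 /mform -(wnormsq_wform nu id) => /ltW MK.
have M_gt0 : 0 < wnormsq nu x.
  by rewrite lt_neqAle eq_sym M0 (wnormsq_wform nu id) wform_ge0.
by rewrite ler_pdivlMr // ler_pdivrMl.
Qed.

(** The competitor is the part of [X + W] orthogonal to the common kernel [W]: it is
    at least as large as [X], and its Rayleigh quotients are quotients of [X]. *)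
Lemma weigenvalue_le mu nu k kap X : 0 < kap ->
  (forall e, 0 <= mu e) -> (k <= \dim X)%N ->
  posdef (fun x y => mform nu x y - kap * kform mu x y) X ->
  (weigenvalue mu nu k <= kap^-1%:E)%E.
Proof.
move=> kap0 hmu kX Xpos; set W := common_ker mu nu.
have dimXW : \dim (X + W) = (\dim X + \dim W)%N.
  apply: (posdef_dim_sum Xpos) => w /common_kerP[m0 k0].
  by rewrite m0 k0 mulr0 subr0.
have [W' [W'P dimW']] := orthogonal_subspace W symform_dot.
apply: ge_ereal_inf; exists (ereal_sup [set wrayleigh mu nu g |
          g in [set g | g \in ((X + W) :&: W')%VS /\ g != 0]]).
  exists ((X + W) :&: W')%VS => //; split=> [|g w /memv_capP[_ gW'] wW].
    have dimW2 : (#|inode G| <= \dim W + \dim W')%N.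
      by rewrite -(dim_ffun_fullv R); exact: dimW'.
    have dimcap := dimv_sum_cap (X + W) W'.
    have dimsum := dimvS (subvf (X + W + W')%VS).
    rewrite dim_ffun_fullv in dimsum; rewrite dimXW in dimcap.
    apply: (leq_trans kX); rewrite -(leq_add2l (\dim (X + W + W'))) dimcap.
    by rewrite addnC -addnA leq_add2l (leq_trans dimsum).
  by move/W'P: gW'; apply.
apply: ge_ereal_sup => _ [g [/memv_capP[gXW gW'] g0] <-].
have /memv_addP[x xX [w wW gE]] := gXW.
have x0 : x != 0.
  apply: contraNneq g0 => x0; apply/eqP/dot_self_eq0.
  by move/W'P: gW'; apply; rewrite gE x0 add0r.
rewrite gE wrayleighD // /wrayleigh.
have := Xpos x xX x0; rewrite /mform -(wnormsq_wform nu id).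
rewrite /kform -(wnormsq_wform mu (@grad R G)) subr_gt0 => KM.
have K0 : 0 <= wnormsq mu (grad x).
  by rewrite (wnormsq_wform mu (@grad R G)) wform_ge0.
have M_gt0 : 0 < wnormsq nu x.
  by apply: le_lt_trans KM; rewrite mulr_ge0 // ltW.
by rewrite gt_eqF // lee_fin ler_pdivrMr // ler_pdivlMl // ltW.
Qed.

End GraphForms.

(** * The signature at a simple eigenvalue *)

Definition pencil (R : realType) (G : wgraph R) (mu : {ffun oedge G -> R})
  (nu : {ffun inode G -> R}) (lam : R) (x y : {ffun inode G -> R}) : R :=
  kform mu x y - lam * mform nu x y.

Section Pencil.
Variables (R : realType) (G : wgraph R).
Variables (mu : {ffun oedge G -> R}) (nu : {ffun inode G -> R}) (k : nat).
Hypothesis hmu : forall e, 0 <= mu e.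
Hypothesis hnu : forall u, 0 <= nu u.
Hypothesis hk : (1 <= k)%N.
Implicit Types (x y g f : {ffun inode G -> R}).
Local Notation K := (kform mu).
Local Notation M := (mform nu).

Lemma symform_pencil lam : symform (pencil mu nu lam).
Proof.
have h := symform_lin 1 (- lam) (symform_kform mu) (symform_mform nu).
have E x y : pencil mu nu lam x y = 1 * K x y + - lam * M x y.
  by rewrite mul1r mulNr.
by split=> [x y|a x y z]; rewrite !E; [exact: h.1 | exact: h.2].
Qed.

Lemma weigenvalue_ge0 : (0 <= weigenvalue mu nu k)%E.
Proof.
apply: le_ereal_inf_tmp => _ [A [kA _] <-].
apply: le_ereal_sup_tmp; exists (wrayleigh mu nu (vpick A)).
  exists (vpick A) => //; split; first exact: memv_pick.
  by rewrite vpick0 -dimv_eq0 -lt0n (leq_trans hk).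
rewrite /wrayleigh; case: ifP => _; first by rewrite leey.
rewrite lee_fin (wnormsq_wform mu (@grad R G)) (wnormsq_wform nu id).
by rewrite divr_ge0 ?wform_ge0.
Qed.

(** If the index of [pencil mu nu lam] were wrong, domination of [K] by the definite
    form would leave room for a factor [1 + t] or [1 - t] on [lam^-1], and the
    min-max value would differ from [lam]. *)
Lemma simple_eigenvalue_index (lam : R) :
  0 < lam -> weigenvalue mu nu k = lam%:E ->
  \dim (weigenspace mu nu lam) = 1%N ->
  exists N P : {vspace {ffun inode G -> R}},
    [/\ posdef (fun x y => - pencil mu nu lam x y) N,
        posdef (pencil mu nu lam) P,
        \dim N = (k - 1)%N, (\dim N + 1 + \dim P)%N = #|inode G|
      & \dim (common_ker mu nu) = 0%N].
Proof.
move=> lam0 wE simple; have hQ := symform_pencil lam.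
have hK := symform_kform mu.
have [N [Z [P [dimNZP Nneg Ppos ZP]]]] := sylvester hQ.
have ZE : Z = weigenspace mu nu lam.
  apply/vspaceP => x; apply/idP/idP.
    by move/ZP => h; apply/weigenspaceP.
  by move/weigenspaceP => h; apply/ZP.
have dimNP : (\dim N + 1 + \dim P)%N = #|inode G|.
  by rewrite -(dim_ffun_fullv R) -dimNZP ZE simple.
(* Any positive [t] with [t < 1] and [t * C < 1] would do, [C] being the constant of
   domination. *)
have theta_ok (C : R) : 0 < C ->
    let t : R := (2 * (C + 1))^-1 in [/\ 0 < t, t < 1 & t * C < 1].
  move=> C0 t; have t0 : 0 < t by rewrite invr_gt0; lra.
  have : t * (2 * (C + 1)) = 1 by rewrite mulVf //; lra.
  by split=> //; nra.
have leNk : (\dim N < k)%N.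
  rewrite ltnNge; apply/negP => leN.
  have [C C0 CN] := posdef_dominates (symform_opp hQ) hK Nneg.
  have [t0 t1 tC] := theta_ok C C0; set t := _^-1 in t0 t1 tC.
  have kap0 : 0 < (1 + t) / lam by rewrite divr_gt0 //; lra.
  have := weigenvalue_le kap0 hmu leN (nu := nu).
  rewrite wE lee_fin invf_div leNgt => /(_ _)/negP; apply.
    move=> x xN x0; have := Nneg x xN x0; have := CN x xN.
    rewrite ler_norml => /andP[_] /(ler_wpM2l (ltW t0)); rewrite /pencil => h1 h2.
    have : 0 < lam * (M x x - (1 + t) / lam * K x x).
      have -> : lam * (M x x - (1 + t) / lam * K x x)
        = lam * M x x - (1 + t) * K x x by field; rewrite gt_eqF.
      by nra.
    by rewrite pmulr_rgt0.
  by rewrite ltr_pdivrMr ?ltr_pMr //; lra.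
have geNk : (k - 1 + \dim (common_ker mu nu) <= \dim N)%N.
  rewrite leqNgt; apply/negP => ltN.
  have [C C0 CP] := posdef_dominates hQ hK Ppos.
  have [t0 t1 tC] := theta_ok C C0; set t := _^-1 in t0 t1 tC.
  have kap0 : 0 < (1 - t) / lam by rewrite divr_gt0 //; lra.
  have dimP : (#|inode G| < k + \dim P + \dim (common_ker mu nu))%N.
    by rewrite -dimNP; move: ltN hk; clear; lia.
  have := weigenvalue_ge hnu kap0 dimP.
  rewrite wE lee_fin invf_div leNgt => /(_ _)/negP; apply.
    move=> x xP x0; have := Ppos x xP x0; have := CP x xP.
    rewrite ler_norml => /andP[_] /(ler_wpM2l (ltW t0)); rewrite /pencil => h1 h2.
    have : 0 < lam * ((1 - t) / lam * K x x - M x x).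
      have -> : lam * ((1 - t) / lam * K x x - M x x)
        = (1 - t) * K x x - lam * M x x by field; rewrite gt_eqF.
      by nra.
    by rewrite pmulr_rgt0.
  by rewrite ltr_pdivlMr ?subr_gt0 // gtr_pMr //; lra.
have arith (a w m : nat) : (1 <= m -> m - 1 + w <= a -> a < m ->
  a = m - 1 /\ w = 0)%N by lia.
have [dN dW] := arith _ _ _ hk geNk leNk.
by exists N, P.
Qed.

End Pencil.

(** * First-order estimates for the inverse eigenvalue *)

Lemma small_pos (R : realFieldType) (a b : R) : 0 < b ->
  exists2 d : R, 0 < d & forall t : R, 0 < t < d -> `|a| * t < b.
Proof.
move=> b0; exists (b / (1 + `|a|)) => [|t /andP[t0]].
  by rewrite divr_gt0 // ltr_pwDl.
rewrite ltr_pdivlMr ?ltr_pwDl // => h; apply: le_lt_trans h.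
by rewrite mulrDr mulr1 mulrC lerDr ltW.
Qed.

Section Perturbation.
Variables (R : realType) (G : wgraph R).
Variables (mu : {ffun oedge G -> R}) (nu : {ffun inode G -> R}) (k : nat).
Hypothesis hmu : forall e, 0 <= mu e.
Hypothesis hnu : forall u, 0 <= nu u.
Variables (lam : R) (f : {ffun inode G -> R}).
Variables (U : {vspace {ffun inode G -> R}}).
Hypothesis lam0 : 0 < lam.
Hypothesis f_rad : forall y, pencil mu nu lam f y = 0.
Implicit Types (x y g : {ffun inode G -> R}).
Local Notation K := (kform mu).
Local Notation M := (mform nu).
Hypothesis Kf : 0 < K f f.

(** Let [kap = lam^-1 + a * t] be the claimed bound. Then [kap] times the perturbed
    Dirichlet form minus the mass form is at least [lam^-1] times the pencil plus [t]
    times a form [T]. Up to the margin [eps], the claimed slope is the one for which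
    [T f f = 0]; with the margin [T f f] is positive, so [finsler] applies. *)
Lemma inv_weigenvalue_edge (e : oedge G) (s eps : R) :
  posdef (pencil mu nu lam) U ->
  (#|inode G| < k + \dim (U + <[f]>))%N -> 0 < eps ->
  exists2 d : R, 0 < d & forall t : R, 0 < t < d ->
    ((weigenvalue (mu + (s * t) *: dlt R e)%R nu k)^-1 <=
     (lam^-1 + - (grad f e ^+ 2 / (lam * K f f)) * (s * t) + eps * t)%:E)%E.
Proof.
move=> Upos ltn eps0.
pose w : R := grad f e ^+ 2; have w0 : 0 <= w by exact: sqr_ge0.
pose a : R := eps - w / (lam * K f f) * s.
(* The slack [eta] absorbs the term of order two in [t]; it is chosen so that it
   costs less than [eps * K f f] at [f]. *)
pose eta : R := eps * K f f / (1 + w).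
have eta0 : 0 < eta by rewrite divr_gt0 ?mulr_gt0 //; lra.
pose B := pencil mu nu lam.
have hK := symform_kform mu; have hG := symform_kform (dlt R e).
have GE x y : kform (dlt R e) x y = grad x e * grad y e.
  rewrite /kform -[dlt R e]scale1r -[X in wform X]add0r wform_dlt mul1r.
  by rewrite /wform big1 ?add0r // => i _; rewrite ffunE mul0r.
pose T x y := (lam * a) * K x y + (s - lam * eta) * kform (dlt R e) x y.
have hT : symform T by exact: symform_lin.
have Tf : 0 < T f f.
  rewrite /T GE -expr2 -/w.
  have -> : lam * a * K f f + (s - lam * eta) * w = lam * (eps * K f f - eta * w).
    by rewrite /a; field; rewrite !gt_eqF.
  rewrite mulr_gt0 // subr_gt0 /eta mulrAC ltr_pdivrMr; last lra.
  by rewrite ltr_pM2l ?mulr_gt0 //; lra.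
have [d1 d10 Hd1] := finsler (symform_pencil mu nu lam) hT Upos f_rad Tf.
have [d2 d20 Hd2] := small_pos (a * s) eta0.
have lamV0 : 0 < lam^-1 by rewrite invr_gt0.
have [d3 d30 Hd3] := small_pos a lamV0.
exists (Num.min d1 (Num.min d2 d3)) => [|t]; first by rewrite !lt_min d10 d20.
rewrite !lt_min => /andP[t0 /and3P[td1 td2 td3]].
have -> : lam^-1 + - (grad f e ^+ 2 / (lam * K f f)) * (s * t) + eps * t
  = lam^-1 + a * t by rewrite /a -/w; ring.
have at_lt : `|a * t| < lam^-1 by rewrite normrM (gtr0_norm t0) Hd3 ?t0.
have ast_lt : `|a * s * t| < eta by rewrite normrM (gtr0_norm t0) Hd2 ?t0.
have kap0 : 0 < lam^-1 + a * t by move: at_lt; rewrite ltr_norml; lra.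
have pos : posdef (fun x y => (lam^-1 + a * t) *
    kform (mu + (s * t) *: dlt R e) x y - mform nu x y) (U + <[f]>).
  move=> x xU x0; have /(_ t) := Hd1; rewrite t0 td1 => /(_ isT x xU x0).
  rewrite /pencil /T GE -expr2 -(pmulr_rgt0 _ lamV0) => /lt_le_trans; apply.
  rewrite /kform wform_dlt -/(kform mu x x) -expr2.
  set q := grad x e ^+ 2; have q0 : 0 <= q by exact: sqr_ge0.
  rewrite -subr_ge0.
  have -> : (lam^-1 + a * t) * (K x x + s * t * q) - M x x
    - lam^-1 * (K x x - lam * M x x +
       t * (lam * a * K x x + (s - lam * eta) * q))
    = t * q * (a * s * t + eta) by field; rewrite gt_eqF.
  rewrite mulr_ge0 ?(mulr_ge0 (ltW t0)) //.
  by move: ast_lt; rewrite ltr_norml; lra.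
have := weigenvalue_ge hnu kap0 (leq_trans ltn (leq_addr _ _)) pos.
set lt := weigenvalue _ _ _ => ge_lt.
have -> : (lam^-1 + a * t)%:E = ((lam^-1 + a * t)^-1%:E)^-1%E :> \bar R.
  by rewrite inver invr_eq0 gt_eqF // invrK.
have ge0 : (0 <= (lam^-1 + a * t)^-1%:E)%E by rewrite lee_fin invr_ge0 ltW.
by rewrite lee_pV2 // inE ?ge0 ?(le_trans ge0 ge_lt).
Qed.

(** The mirror image of [inv_weigenvalue_edge]: raising a node weight raises the
    denominator, and the bound now comes from the negative directions. Here the
    perturbed form is linear in [t]. *)
Lemma inv_weigenvalue_node (u : inode G) (s eps : R) :
  posdef (fun x y => - pencil mu nu lam x y) U ->
  (1 <= k)%N -> (k <= \dim (U + <[f]>))%N -> 0 < eps ->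
  exists2 d : R, 0 < d & forall t : R, 0 < t < d -> 0 <= nu u + s * t ->
    ((lam^-1 + (f u ^+ 2 / K f f) * (s * t) - eps * t)%:E <=
     (weigenvalue mu (nu + (s * t) *: dlt R u)%R k)^-1)%E.
Proof.
move=> Uneg hk leU eps0.
pose a : R := f u ^+ 2 / K f f * s - eps.
have hQ := symform_pencil mu nu lam.
have hK := symform_kform mu; have hD := symform_mform (dlt R u).
have DE x y : mform (dlt R u) x y = x u * y u.
  rewrite /mform -[dlt R u]scale1r -[X in wform X]add0r wform_dlt mul1r.
  by rewrite /wform big1 ?add0r // => i _; rewrite ffunE mul0r.
pose T x y := (- (lam * a)) * K x y + (lam * s) * mform (dlt R u) x y.
have hT : symform T by exact: symform_lin.
have Tf : 0 < T f f.
  rewrite /T DE -expr2.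
  have -> : - (lam * a) * K f f + lam * s * f u ^+ 2 = lam * eps * K f f.
    by rewrite /a; field; rewrite !gt_eqF.
  by rewrite !mulr_gt0.
have f_nrad y : - pencil mu nu lam f y = 0 by rewrite f_rad oppr0.
have [d1 d10 Hd1] := finsler (symform_opp hQ) hT Uneg f_nrad Tf.
have lamV0 : 0 < lam^-1 by rewrite invr_gt0.
have [d3 d30 Hd3] := small_pos a lamV0.
exists (Num.min d1 d3) => [|t]; first by rewrite !lt_min d10 d30.
rewrite !lt_min => /andP[t0 /andP[td1 td3]] nut0.
have -> : lam^-1 + (f u ^+ 2 / K f f) * (s * t) - eps * t
  = lam^-1 + a * t by rewrite /a; ring.
have at_lt : `|a * t| < lam^-1 by rewrite normrM (gtr0_norm t0) Hd3 ?t0.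
have kap0 : 0 < lam^-1 + a * t by move: at_lt; rewrite ltr_norml; lra.
have pos : posdef (fun x y => mform (nu + (s * t) *: dlt R u) x y -
    (lam^-1 + a * t) * kform mu x y) (U + <[f]>).
  move=> x xU x0; have /(_ t) := Hd1; rewrite t0 td1 => /(_ isT x xU x0).
  rewrite /pencil /T DE -(pmulr_rgt0 _ lamV0).
  rewrite /mform wform_dlt -/(mform nu x x) /=.
  congr (_ < _); field; rewrite gt_eqF //.
have := weigenvalue_le kap0 hmu leU pos.
set lt := weigenvalue _ _ _ => ge_lt.
have -> : (lam^-1 + a * t)%:E = ((lam^-1 + a * t)^-1%:E)^-1%E :> \bar R.
  by rewrite inver invr_eq0 gt_eqF // invrK.
have ge0 : (0 <= (lam^-1 + a * t)^-1%:E)%E by rewrite lee_fin invr_ge0 ltW.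
have lt0 : (0 <= lt)%E.
  apply: weigenvalue_ge0 => // v; rewrite !ffunE /GRing.scale /=.
  by case: eqP => [->|_]; rewrite ?mulr1 // mulr0 addr0.
by rewrite lee_pV2 // inE.
Qed.

End Perturbation.

(** * Second derivatives of ratios of power sums *)

Section Calculus.
Local Open Scope classical_set_scope.

(** This single formula yields the first two derivatives of [`|y| `^ p] for [2 < p],
    and the derivative of the penalty [y `^ (p / (p - 2))], also at [y = 0]. *)
Lemma is_derive_norm_powRM (R : realType) (q x : R) : 0 < q ->
  is_derive x 1 (fun y : R => `|y| `^ q * y) ((q + 1) * `|x| `^ q).
Proof.
move=> q0; have pos (z : R) : 0 < z ->
    is_derive z 1 (fun y : R => y `^ q * y) ((q + 1) * `|z| `^ q).
  move=> z0; apply: is_derive_eq.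
    by apply: is_deriveM; apply: is_derive1_powR.
  rewrite gtr0_norm // /GRing.scale /= mulr1 mulrCA mulr_powRB1 ?ltW //.
  by rewrite mulrDl mul1r addrC.
have [x0|x0|->] := ltgtP x 0.
- have x0N : 0 < - x by rewrite oppr_gt0.
  have h : is_derive x 1 (fun y : R => - ((- y) `^ q * - y)) ((q + 1) * `|x| `^ q).
    apply: is_derive_eq.
      apply: is_deriveN; apply: (@is_derive1_comp _ (fun y => y `^ q * y) -%R).
      exact: pos.
    by rewrite normrN mulrN1 opprK.
  apply: near_eq_is_derive h; near=> y.
  have y0 : y < 0 by near: y; exact: lt_nbhsl.
  by rewrite (ltr0_norm y0) mulrN opprK.
- apply: near_eq_is_derive (pos x x0); near=> y.
  by rewrite gtr0_norm //; near: y; exact: lt_nbhsr.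
have cvg0 : (h^-1 *: (((fun y : R => `|y| `^ q * y) \o shift 0) (h *: 1)
    - `|0 : R| `^ q * 0)) @[h --> (0 : R)^'] --> (0 : R).
  apply/cvgrPdist_lt => eps eps0; near=> h.
  have h0 : h != 0 by near: h; exact: nbhs_dnbhs_neq.
  rewrite sub0r normrN mulr0 subr0 /= addr0 /GRing.scale /= mulr1 mulrCA.
  rewrite mulVf // mulr1 ger0_norm ?powR_ge0 //.
  have -> : eps = (eps `^ q^-1) `^ q.
    by rewrite -powRrM mulVf ?powRr1 ?gt_eqF // ltW.
  apply: gt0_ltr_powR => //; rewrite ?nnegrE ?powR_ge0 //.
  by near: h; apply: dnbhs0_lt; rewrite powR_gt0.
rewrite normr0 powR0 ?gt_eqF // mulr0; split; first by apply/cvg_ex; exists 0.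
exact/cvg_lim.
Unshelve. all: by end_near. Qed.

Section PowerSums.
Variables (R : realType) (p : R).
Hypothesis p_gt2 : 2 < p.

Lemma norm_powR_split (x : R) : `|x| `^ p = `|x| `^ (p - 2) * x * x.
Proof.
rewrite -mulrA -expr2 -(real_normK (num_real x)) -powR_mulrn // -powRD.
  by rewrite subrK.
by rewrite subrK gt_eqF // (lt_trans _ p_gt2).
Qed.

Lemma is_derive_norm_powR (x : R) :
  is_derive x 1 (fun y : R => `|y| `^ p) (p * (`|x| `^ (p - 2) * x)).
Proof.
have -> : (fun y : R => `|y| `^ p) = (fun y => `|y| `^ (p - 2) * y) * id.
  by apply/funext => y; rewrite norm_powR_split.
have h : 0 < p - 2 by rewrite subr_gt0.
apply: is_derive_eq.
  by apply: is_deriveM; apply: is_derive_norm_powRM.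
by rewrite /GRing.scale /=; ring.
Qed.

Lemma is_derive_line (F : R -> R) (a b dF : R) : is_derive a 1 F dF ->
  is_derive (0 : R) 1 (fun t => F (a + t * b)) (dF * b).
Proof.
move=> Fa.
have h1 : is_derive (0 : R) 1 (fun t => a + t * b) b.
  by apply: is_derive_eq; rewrite /GRing.scale /= mulr1 mul0r !add0r mul1r.
have h2 : is_derive (a + 0 * b) 1 F dF by rewrite mul0r addr0.
exact: (@is_derive1_comp R F (fun t => a + t * b) 0 dF b h2 h1).
Qed.

Lemma is_derive_bigsum (S : finType) (F : S -> R -> R) (dF : S -> R) (x : R) :
  (forall s, is_derive x 1 (F s) (dF s)) ->
  is_derive x 1 (fun t => \sum_s F s t) (\sum_s dF s).
Proof.
move=> hF; have -> : (fun t => \sum_s F s t) = \sum_s F s.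
  by apply/funext => t; rewrite fct_sumE.
by apply: (big_ind2 (fun g dg => is_derive x 1 g dg)) => // [|*];
  [exact: is_derive_cst|exact: is_deriveD].
Qed.

Variables (T S : finType) (L : {ffun T -> R} -> {ffun S -> R}).
Hypothesis L_linear : linear L.
Implicit Types (f g v w : {ffun T -> R}).

Lemma linear_line g v (t : R) s : L (g + t *: v) s = L g s + t * L v s.
Proof. by rewrite addrC L_linear !ffunE addrC. Qed.

Definition psum g := \sum_s `|L g s| `^ p.

(** The derivative of [psum] at [g] in the direction [v]. *)
Definition psum1 g v :=
  \sum_s p * (`|L g s| `^ (p - 2) * L g s) * L v s.

(** The weights for which [wform] is the second derivative of [psum] at [g]. *)
Definition pweight g : {ffun S -> R} :=
  [ffun s => p * (p - 1) * `|L g s| `^ (p - 2)].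

Lemma is_derive_psum g v :
  is_derive (0 : R) 1 (fun t => psum (g + t *: v)) (psum1 g v).
Proof.
apply: is_derive_bigsum => s.
rewrite (_ : (fun t => _) = fun t => `|L g s + t * L v s| `^ p).
  exact: (is_derive_line (L v s) (is_derive_norm_powR (L g s))).
by apply/funext => t; rewrite linear_line.
Qed.

Lemma is_derive_psum1 g v w :
  is_derive (0 : R) 1 (fun t => psum1 (g + t *: w) v)
    (wform (pweight g) L w v).
Proof.
apply: is_derive_bigsum => s.
have h : 0 < p - 2 by rewrite subr_gt0.
have hd := is_derive_line (L w s) (is_derive_norm_powRM (L g s) h).
pose F t := `|L g s + t * L w s| `^ (p - 2) * (L g s + t * L w s).
rewrite (_ : (fun t => _) = F * cst (p * L v s)).
  have hF : is_derive (0 : R) 1 F ((p - 2 + 1) * `|L g s| `^ (p - 2) * L w s).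
    exact: hd.
  apply: is_derive_eq; rewrite ffunE /GRing.scale /= mulr0 add0r /cst; ring.
by apply/funext => t; rewrite linear_line -[RHS]/(F t * (p * L v s)) /F; ring.
Qed.

End PowerSums.

Lemma is_derive_quotient (R : realType) (u w : R -> R) (x du dw : R) :
  w x != 0 -> is_derive x 1 u du -> is_derive x 1 w dw ->
  is_derive x 1 (fun t => u t / w t) ((du * w x - u x * dw) / w x ^+ 2).
Proof.
move=> w0 hu hw; have hV := is_deriveV w0 hw.
rewrite (_ : (fun t => _) = u * (fun t => (w t)^-1)); last exact/funext.
by apply: is_derive_eq; rewrite /GRing.scale /=; field.
Qed.

Section RayleighHessian.
Variables (R : realType) (p : R).
Hypothesis p_gt2 : 2 < p.
Variables (T S : finType) (L : {ffun T -> R} -> {ffun S -> R}).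
Hypothesis L_linear : linear L.
Implicit Types (f g v w : {ffun T -> R}).

Local Notation a := (psum p L).
Local Notation b := (psum p (@id {ffun T -> R})).
Local Notation a1 := (psum1 p L).
Local Notation b1 := (psum1 p (@id {ffun T -> R})).

Let id_linear : linear (@id {ffun T -> R}). Proof. by []. Qed.

Lemma is_derive_ratio (c : R) g v : b g != 0 ->
  is_derive (0 : R) 1 (fun t => c * (a (g + t *: v) / b (g + t *: v)))
    (c * ((a1 g v * b g - a g * b1 g v) / b g ^+ 2)).
Proof.
move=> bg; have ha := is_derive_psum p_gt2 L_linear g v.
have hb := is_derive_psum p_gt2 id_linear g v.
have := is_derive_quotient _ ha hb; rewrite scale0r addr0 => /(_ bg) hq.
rewrite (_ : (fun t => _) = c \*: (fun t => a (g + t *: v) / b (g + t *: v))) //.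
exact: is_deriveZ.
Qed.

Lemma pderiv_ratio (c : R) g i : b g != 0 ->
  pderiv (fun g => c * (a g / b g)) i g =
  c * ((a1 g (dlt R i) * b g - a g * b1 g (dlt R i)) / b g ^+ 2).
Proof.
move=> bg; rewrite /pderiv derive1E.
by have h := is_derive_ratio c (dlt R i) bg; rewrite derive_val.
Qed.

(** At a critical point the numerator of the first derivative vanishes and the
    mixed products of first derivatives cancel, so that only the second derivatives
    of [a] and [b] survive. *)
Lemma hessian_ratio (c : R) f i j : b f != 0 ->
  (forall v, a1 f v = a f / b f * b1 f v) ->
  hessian (fun g => c * (a g / b g)) f i j =
  c / b f * (wform (pweight p L f) L (dlt R i) (dlt R j) -
    a f / b f * wform (pweight p id f) id (dlt R i) (dlt R j)).
Proof.
move=> bf crit; rewrite /hessian {1}/pderiv derive1E.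
set di := dlt R i; set dj := dlt R j.
have ha := is_derive_psum p_gt2 L_linear f di.
have hb := is_derive_psum p_gt2 id_linear f di.
have ha1 := is_derive_psum1 p_gt2 L_linear f dj di.
have hb1 := is_derive_psum1 p_gt2 id_linear f dj di.
have near0 : \forall t \near (0 : R), b (f + t *: di) != 0.
  have : {for (0 : R), continuous (fun t : R => b (f + t *: di))}.
    by apply: differentiable_continuous; apply/derivable1_diffP; case: hb.
  move/cvgr_neq0; apply; by rewrite scale0r addr0.
rewrite (near_eq_derive 1 (g := fun t : R => c * ((a1 (f + t *: di) dj *
   b (f + t *: di) - a (f + t *: di) * b1 (f + t *: di) dj) /
   b (f + t *: di) ^+ 2))); last first.
  near=> t; rewrite pderiv_ratio //; near: t; exact: near0.
pose u (t : R) := a1 (f + t *: di) dj * b (f + t *: di)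
  - a (f + t *: di) * b1 (f + t *: di) dj.
have hu : is_derive (0 : R) 1 u
   (wform (pweight p L f) L di dj * b f - a f * wform (pweight p id f) id di dj).
  rewrite (_ : u = (fun t => a1 (f + t *: di) dj) * (fun t => b (f + t *: di))
    - (fun t => a (f + t *: di)) * (fun t => b1 (f + t *: di) dj)) //.
  apply: is_derive_eq; rewrite /= !scale0r !addr0 /GRing.scale /= !crit.
  ring.
have u0 : u 0 = 0.
  by rewrite /u scale0r addr0 crit; field.
pose w (t : R) := b (f + t *: di) ^+ 2.
have hw : exists dw, is_derive (0 : R) 1 w dw.
  eexists; rewrite (_ : w = (fun t => b (f + t *: di)) ^+ 2); last first.
    by apply/funext => t; rewrite /w expr2.
  exact: is_deriveX.
have [dw hdw] := hw.
have w0 : w 0 = b f ^+ 2 by rewrite /w scale0r addr0.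
have w0n : w 0 != 0 by rewrite w0 expf_neq0.
have hq := is_deriveZ c (is_derive_quotient w0n hu hdw).
rewrite (_ : (fun t => _) = c \*: (fun t => u t / w t)) //.
rewrite derive_val u0 w0 mul0r subr0 /GRing.scale /=.
by field.
Unshelve. all: by end_near. Qed.

Lemma symform_dlt_sum (B : {ffun T -> R} -> {ffun T -> R} -> R) v w :
  symform B -> \sum_i \sum_j v i * B (dlt R i) (dlt R j) * w j = B v w.
Proof.
move=> hB; rewrite [in RHS](ffun_dlt_sum v) (symform_suml hB); apply: eq_bigr => i _.
rewrite [in RHS](ffun_dlt_sum w) (symform_sumr hB) mulr_sumr; apply: eq_bigr => j _.
by rewrite -mulrA (mulrC (B _ _)).
Qed.

Lemma hessian_ratio_form (c : R) f v : b f != 0 ->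
  (forall v, a1 f v = a f / b f * b1 f v) ->
  \sum_i \sum_j v i * hessian (fun g => c * (a g / b g)) f i j * v j =
  c / b f * (wform (pweight p L f) L v v -
    a f / b f * wform (pweight p id f) id v v).
Proof.
move=> bf crit.
pose B x y := c / b f * wform (pweight p L f) L x y +
  (- (c / b f * (a f / b f))) * wform (pweight p id f) id x y.
have hB : symform B by apply: symform_lin; exact: symform_wform.
have -> : c / b f * (wform (pweight p L f) L v v -
    a f / b f * wform (pweight p id f) id v v) = B v v.
  by rewrite /B; ring.
rewrite -(symform_dlt_sum v v hB); apply: eq_bigr => i _.
by apply: eq_bigr => j _; rewrite hessian_ratio // /B; ring.
Qed.

End RayleighHessian.

(** * Morse index and saddle conditions *)

Lemma morse_index_eq (R : realType) (T : finType)
    (phi : {ffun T -> R} -> R) (x : {ffun T -> R})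
    (B : {ffun T -> R} -> {ffun T -> R} -> R)
    (N P : {vspace {ffun T -> R}}) :
  (forall v : {ffun T -> R},
     \sum_i \sum_j v i * hessian phi x i j * v j < 0 <-> B v v < 0) ->
  posdef (fun v w => - B v w) N -> {in P, forall v, 0 <= B v v} ->
  (\dim N + \dim P = #|T|)%N ->
  morse_index phi x = \dim N.
Proof.
move=> hessB Nneg Ppos dimNP; apply/eqP; rewrite eqn_leq; apply/andP; split.
  apply/bigmax_leqP => m /asboolP[A Aneg <-]; rewrite leqNgt; apply/negP => lt.
  have [g /memv_capP[gA gP] g0] : exists2 g, g \in (A :&: P)%VS & g != 0.
    by apply: exists_nonzero_cap; rewrite dim_ffun_fullv -dimNP ltn_add2r.
  have /hessB := Aneg g gA g0; by rewrite ltNge Ppos.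
have ltN : (\dim N < #|T|.+1)%N by rewrite ltnS -dimNP leq_addr.
apply: (leq_trans _ (leq_bigmax_cond (Ordinal ltN) _)) => //.
apply/asboolP; exists N => // v vN v0; apply/hessB.
by rewrite -oppr_gt0; apply: Nneg.
Qed.

Lemma orthant_pderiv_near (R : realType) (T : finType)
    (phi : {ffun T -> R} -> \bar R) x i (d s : R) (A : set (\bar R)) :
  orthant_pderiv phi x i d -> s != 0 -> nbhs d%:E A ->
  exists2 e : R, 0 < e & forall t : R, 0 < t < e -> 0 <= x i + s * t ->
    A ((phi (x + (s * t) *: dlt R i)%R - phi x) * ((s * t)^-1)%:E)%E.
Proof.
move=> hphi s0 /hphi; rewrite /fmap /= /within /= => /nbhs_ballP[e /= e0 He].
exists (e / `|s|) => [|t /andP[t0 te] xt]; first by rewrite divr_gt0 ?normr_gt0.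
apply: He => //=; last by rewrite mulf_neq0 // gt_eqF.
rewrite /ball /= sub0r normrN normrM (gtr0_norm t0) mulrC -ltr_pdivlMr //.
by rewrite normr_gt0.
Qed.

(** An increment to the right bounds the derivative by [a]; at an interior point an
    increment to the left bounds it from the other side. *)
Lemma orthant_pderiv_upper (R : realType) (T : finType)
    (phi : {ffun T -> R} -> \bar R) x i (d r a : R) :
  orthant_pderiv phi x i d -> 0 <= x i -> phi x = r%:E ->
  (forall s eps : R, s != 0 -> 0 < eps -> exists2 e : R, 0 < e &
    forall t : R, 0 < t < e -> 0 <= x i + s * t ->
    (phi (x + (s * t) *: dlt R i)%R <= (r + a * (s * t) + eps * t)%:E)%E) ->
  d <= a /\ (0 < x i -> d = a).
Proof.
move=> hphi x0 phix ub.
have quot (t eps y : R) : 0 < t -> (phi (x + y *: dlt R i)%R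
     <= (r + a * y + eps * t)%:E)%E ->
   ((phi (x + y *: dlt R i)%R - phi x) * (t^-1)%:E <=
     (a * (y / t) + eps)%:E)%E.
  move=> t0 le; have tV0 : (0 <= (t^-1)%:E)%E by rewrite lee_fin invr_ge0 ltW.
  apply: (@le_trans _ _ (((r + a * y + eps * t)%:E - r%:E) * (t^-1)%:E)%E).
    by apply: lee_wpmul2r => //; rewrite phix; apply: leeB.
  rewrite -EFinB -EFinM lee_fin le_eqVlt; apply/orP; left; apply/eqP.
  by field; rewrite gt_eqF.
have le_da : d <= a.
  rewrite leNgt; apply/negP => ad; pose eps := (d - a) / 3.
  have eps0 : 0 < eps by rewrite divr_gt0 ?subr_gt0.
  have hA : nbhs d%:E [set y : \bar R | ((d - eps)%:E < y)%E].
    have : \forall z \near d, ((d - eps)%:E < z%:E)%E.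
      near=> z; rewrite lte_fin; near: z; apply: lt_nbhsr.
      by rewrite ltrBlDr ltrDl.
    by [].
  have s0 : (1 : R) != 0 by [].
  have [e1 e10 H1] := orthant_pderiv_near hphi s0 hA.
  have [e2 e20 H2] := ub 1 eps s0 eps0.
  pose t := Num.min e1 e2 / 2.
  have m0 : 0 < Num.min e1 e2 by rewrite lt_min e10.
  have t0 : 0 < t by rewrite divr_gt0.
  have : t < Num.min e1 e2 by rewrite /t; lra.
  rewrite lt_min => /andP[te1 te2].
  have xt : 0 <= x i + 1 * t by rewrite mul1r addr_ge0 // ltW.
  have := H1 t; rewrite t0 te1 => /(_ isT xt) /=.
  have := H2 t; rewrite t0 te2 => /(_ isT xt) /(quot _ _ _ t0).
  rewrite mul1r divff ?gt_eqF // mulr1 => le1 /lt_le_trans /(_ le1).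
  by rewrite lte_fin /eps; lra.
split=> // xi0; apply/eqP; rewrite eq_le le_da /=.
rewrite leNgt; apply/negP => ad; pose eps := (a - d) / 3.
have eps0 : 0 < eps by rewrite divr_gt0 ?subr_gt0.
have hA : nbhs d%:E [set y : \bar R | (y < (d + eps)%:E)%E].
  have : \forall z \near d, (z%:E < (d + eps)%:E)%E.
    by near=> z; rewrite lte_fin; near: z; apply: lt_nbhsl; rewrite ltrDl.
  by [].
have s0 : (-1 : R) != 0 by rewrite oppr_eq0.
have [e1 e10 H1] := orthant_pderiv_near hphi s0 hA.
have [e2 e20 H2] := ub (-1) eps s0 eps0.
pose t := Num.min (x i) (Num.min e1 e2) / 2.
have m0 : 0 < Num.min (x i) (Num.min e1 e2) by rewrite !lt_min xi0 e10.
have t0 : 0 < t by rewrite divr_gt0.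
have : t < Num.min (x i) (Num.min e1 e2) by rewrite /t; lra.
rewrite !lt_min => /and3P[tx te1 te2].
have xt : 0 <= x i + -1 * t by rewrite mulN1r subr_ge0 ltW.
have := H1 t; rewrite t0 te1 => /(_ isT xt) /=.
have := H2 t; rewrite t0 te2 => /(_ isT xt) /(quot _ _ _ t0).
rewrite mulN1r mulNr divff ?gt_eqF // invrN EFinN muleN mulrN1 => le1 lt1.
move: lt1; rewrite lteNl => /lt_le_trans /(_ le1).
by rewrite -EFinN lte_fin /eps; lra.
Unshelve. all: by end_near. Qed.

Lemma orthant_pderiv_lower (R : realType) (T : finType)
    (phi : {ffun T -> R} -> \bar R) x i (d r a : R) :
  orthant_pderiv phi x i d -> 0 <= x i -> phi x = r%:E ->
  (forall s eps : R, s != 0 -> 0 < eps -> exists2 e : R, 0 < e &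
    forall t : R, 0 < t < e -> 0 <= x i + s * t ->
    ((r + a * (s * t) - eps * t)%:E <= phi (x + (s * t) *: dlt R i)%R)%E) ->
  a <= d /\ (0 < x i -> d = a).
Proof.
move=> hphi x0 phix lb.
have hphiN : orthant_pderiv (fun z => - phi z)%E x i (- d).
  rewrite /orthant_pderiv EFinN.
  rewrite (_ : (fun h => _) = (fun h : R =>
    - ((phi (x + h *: dlt R i)%R - phi x) * (h^-1)%:E))%E).
    exact: cvgeN.
  apply/funext => h; rewrite phix oppeK -mulNe.
  by rewrite fin_num_oppeB.
have [] := orthant_pderiv_upper (a := - a) hphiN x0 (r := - r).
- by rewrite phix EFinN.
- move=> s eps s0 eps0; have [e e0 He] := lb s eps s0 eps0.
  exists e => // t te xt; rewrite leeNl -EFinN.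
  have -> : - (- r + - a * (s * t) + eps * t) = r + a * (s * t) - eps * t by ring.
  exact: He.
- by rewrite lerN2 => ad h; split=> // /h/oppr_inj.
Qed.

Lemma sum_powR_dlt (R : realType) (T : finType) (x : {ffun T -> R}) i
    (q h : R) :
  \sum_j (x + h *: dlt R i) j `^ q =
  \sum_j x j `^ q + ((x i + h) `^ q - x i `^ q).
Proof.
rewrite (bigD1 i) //= [in RHS](bigD1 i) //= !ffunE eqxx /GRing.scale /= mulr1.
rewrite [X in _ + X = _](eq_bigr (fun j => x j `^ q)); last first.
  by move=> j /negPf nej; rewrite !ffunE nej /GRing.scale /= mulr0 addr0.
ring.
Qed.

(** The factor [(p - 2) / p] is the inverse of the exponent [2 / (p - 2) + 1], so the
    penalty has derivative [z `^ (2 / (p - 2))]. *)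
Lemma powR_increment (R : realType) (p z s eps : R) : 2 < p -> 0 <= z ->
  s != 0 -> 0 < eps ->
  exists2 e : R, 0 < e & forall t : R, 0 < t < e -> 0 <= z + s * t ->
    `|(p - 2) / p * ((z + s * t) `^ (p / (p - 2)) - z `^ (p / (p - 2)))
      - z `^ (2 / (p - 2)) * (s * t)| <= eps * t.
Proof.
move=> p2 z0 s0 eps0; have h0 : 0 < p - 2 by rewrite subr_gt0.
set q := 2 / (p - 2); have q0 : 0 < q by rewrite divr_gt0.
have -> : p / (p - 2) = q + 1 by rewrite /q; field; rewrite gt_eqF.
have -> : (p - 2) / p = (q + 1)^-1.
  by rewrite /q; field; rewrite !gt_eqF //; lra.
have powE y : 0 <= y -> y `^ (q + 1) = `|y| `^ q * y.
  move=> y0; rewrite ger0_norm // powRD ?powRr1 //.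
  by rewrite gt_eqF //; lra.
have [/cvg_ex[l hl] dv] := is_derive_norm_powRM z q0.
have lE : l = (q + 1) * `|z| `^ q by rewrite -dv; apply/esym/cvg_lim.
have s1 : 0 < (q + 1) * eps / `|s| by rewrite divr_gt0 ?mulr_gt0 ?normr_gt0 //; lra.
move/cvgrPdist_le : hl => /(_ _ s1); rewrite near_withinE.
move=> /nbhs_ballP[e /= e0 He].
exists (e / `|s|) => [|t /andP[t0 te] zt]; first by rewrite divr_gt0 ?normr_gt0.
have st0 : s * t != 0 by rewrite mulf_neq0 // gt_eqF.
have /(_ _ st0) := He (s * t); rewrite /ball /= sub0r normrN normrM (gtr0_norm t0).
rewrite mulrC -ltr_pdivlMr ?normr_gt0 // te => /(_ isT).
rewrite /GRing.scale /= mulr1 lE !powE //.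
rewrite (addrC (s * t)) (ger0_norm z0) (ger0_norm zt).
set D := (z + s * t) `^ q * _ - _ => hD.
have q10 : 0 < q + 1 by lra.
have -> : (q + 1)^-1 * D - z `^ q * (s * t) =
   - ((q + 1)^-1 * (s * t)) * ((q + 1) * z `^ q - (s * t)^-1 * D).
  by field; rewrite s0 !gt_eqF.
rewrite normrM; apply: (le_trans (ler_wpM2l (normr_ge0 _) hD)).
rewrite normrN !normrM (gtr0_norm t0) gtr0_norm ?invr_gt0 //.
rewrite le_eqVlt; apply/orP; left; apply/eqP.
by field; rewrite normr_eq0 s0 gt_eqF.
Qed.

End Calculus.

Section Saddle.
Variables (R : realType) (G : wgraph R) (p : R) (k : nat).
Variables (mu : {ffun oedge G -> R}) (nu f : {ffun inode G -> R}).
Variables (lam : R) (U : {vspace {ffun inode G -> R}}).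
Hypothesis p_gt2 : 2 < p.
Hypothesis k_ge1 : (1 <= k)%N.
Hypothesis mu_ge0 : forall e, 0 <= mu e.
Hypothesis nu_ge0 : forall u, 0 <= nu u.
Hypothesis lam_gt0 : 0 < lam.
Hypothesis lamE : weigenvalue mu nu k = lam%:E.
Hypothesis f_rad : forall y, pencil mu nu lam f y = 0.
Hypothesis Kf_gt0 : 0 < kform mu f f.

Let f_neq0 : f != 0.
Proof.
apply: contraTneq Kf_gt0 => ->.
by rewrite (symform0l (symform_kform mu)) ltxx.
Qed.

Lemma energy_at : energy p k mu nu =
  (lam^-1 + (p - 2) / p * \sum_e mu e `^ (p / (p - 2))
   - (p - 2) / p * \sum_u nu u `^ (p / (p - 2)))%:E.
Proof. by rewrite /energy lamE inver gt_eqF // -EFinD -EFinB. Qed.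

(** When [mu e = 0] the estimate gives [0 <= d <= - gam] with [0 <= gam], so that
    [gam] vanishes as well and both cases have the same conclusion. *)
Lemma saddle_edge_weight e d :
  posdef (pencil mu nu lam) U -> (#|inode G| <= k + \dim U)%N ->
  orthant_pderiv (fun m => energy p k m nu) mu e d ->
  0 <= d -> (0 < mu e -> d = 0) ->
  mu e `^ (2 / (p - 2)) = grad f e ^+ 2 / (lam * kform mu f f).
Proof.
move=> Upos leU hd d0 dmu; set gam := grad f e ^+ 2 / _.
have gam0 : 0 <= gam.
  by rewrite divr_ge0 ?sqr_ge0 ?mulr_ge0 ?(ltW lam_gt0) ?(ltW Kf_gt0).
have dimX : (#|inode G| < k + \dim (U + <[f]>))%N.
  have hQ := symform_pencil mu nu lam.
  by rewrite (posdef_dim_line hQ Upos f_rad f_neq0) addnA addn1 ltnS.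
have [] := orthant_pderiv_upper (a := - gam + mu e `^ (2 / (p - 2)))
  hd (mu_ge0 e) energy_at.
  move=> s eps s0 eps0; have eps20 : 0 < eps / 2 by rewrite divr_gt0.
  have [e1 e10 H1] := inv_weigenvalue_edge nu_ge0 lam_gt0 f_rad Kf_gt0 e s
    Upos dimX eps20.
  have [e2 e20 H2] := powR_increment p_gt2 (mu_ge0 e) s0 eps20.
  exists (Num.min e1 e2) => [|t]; first by rewrite lt_min e10.
  rewrite lt_min => /andP[t0 /andP[te1 te2]] xt.
  have := H1 t; rewrite t0 te1 => /(_ isT) ev.
  have := H2 t; rewrite t0 te2 => /(_ isT xt); rewrite ler_norml => /andP[_ pw].
  rewrite /energy sum_powR_dlt.
  apply: le_trans (leeB (leeD ev (lexx _)) (lexx _)) _.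
  rewrite -EFinD lee_fin -/gam; move: pw.
  by set c := (p - 2) / p; rewrite !mulrDr !mulrN; lra.
move=> le_d d_eq; have [mu0|mu0] := eqVneq (mu e) 0.
  have q0 : 2 / (p - 2) != 0 by rewrite gt_eqF // divr_gt0 ?subr_gt0.
  move: le_d; rewrite mu0 powR0 // => le_d; lra.
have mu_gt0 : 0 < mu e by rewrite lt_neqAle eq_sym mu0 mu_ge0.
by have := d_eq mu_gt0; rewrite dmu //; lra.
Qed.

Lemma saddle_node_weight u d :
  posdef (fun x y => - pencil mu nu lam x y) U -> (k <= \dim U + 1)%N ->
  orthant_pderiv (fun n => energy p k mu n) nu u d ->
  d <= 0 -> (0 < nu u -> d = 0) ->
  nu u `^ (2 / (p - 2)) = f u ^+ 2 / kform mu f f.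
Proof.
move=> Uneg leU hd d0 dnu; set gam := f u ^+ 2 / _.
have gam0 : 0 <= gam by rewrite divr_ge0 ?sqr_ge0 ?(ltW Kf_gt0).
have dimX : (k <= \dim (U + <[f]>))%N.
  have hNQ := symform_opp (symform_pencil mu nu lam).
  have f_nrad y : - pencil mu nu lam f y = 0 by rewrite f_rad oppr0.
  by rewrite (posdef_dim_line hNQ Uneg f_nrad f_neq0).
have [] := orthant_pderiv_lower (a := gam - nu u `^ (2 / (p - 2)))
  hd (nu_ge0 u) energy_at.
  move=> s eps s0 eps0; have eps20 : 0 < eps / 2 by rewrite divr_gt0.
  have [e1 e10 H1] := inv_weigenvalue_node mu_ge0 nu_ge0 lam_gt0 f_rad Kf_gt0 u s
    Uneg k_ge1 dimX eps20.
  have [e2 e20 H2] := powR_increment p_gt2 (nu_ge0 u) s0 eps20.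
  exists (Num.min e1 e2) => [|t]; first by rewrite lt_min e10.
  rewrite lt_min => /andP[t0 /andP[te1 te2]] xt.
  have := H1 t; rewrite t0 te1 => /(_ isT xt) ev.
  have := H2 t; rewrite t0 te2 => /(_ isT xt); rewrite ler_norml => /andP[_ pw].
  rewrite /energy sum_powR_dlt.
  apply: le_trans _ (leeB (leeD ev (lexx _)) (lexx _)).
  rewrite -EFinD lee_fin -/gam; move: pw.
  by set c := (p - 2) / p; rewrite !mulrDr !mulrN; lra.
move=> le_d d_eq; have [nu0|nu0] := eqVneq (nu u) 0.
  have q0 : 2 / (p - 2) != 0 by rewrite gt_eqF // divr_gt0 ?subr_gt0.
  move: le_d; rewrite nu0 powR0 // => le_d; lra.
have nu_gt0 : 0 < nu u by rewrite lt_neqAle eq_sym nu0 nu_ge0.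
by have := d_eq nu_gt0; rewrite dnu //; lra.
Qed.

End Saddle.

(** * Weights matching an eigenfunction *)

Lemma powR_weight (R : realType) (p w c x : R) : 2 < p -> 0 <= w -> 0 < c ->
  w `^ (2 / (p - 2)) = x ^+ 2 / c ->
  w = (c `^ ((p - 2) / 2))^-1 * `|x| `^ (p - 2).
Proof.
move=> p2 w0 c0 wE; have p20 : 0 < p - 2 by rewrite subr_gt0.
have -> : w = (w `^ (2 / (p - 2))) `^ ((p - 2) / 2).
  rewrite -powRrM (_ : _ * _ = 1) ?powRr1 //.
  by field; rewrite gt_eqF.
rewrite wE powRM ?sqr_ge0 ?invr_ge0 ?(ltW c0) // mulrC; congr (_ * _).
  by rewrite -powR_inv1 ?(ltW c0) // -powRN -powRrM mulN1r.
rewrite -(real_normK (num_real x)) -powR_mulrn // -powRrM; congr (_ `^ _).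
by field.
Qed.

Section MatchingWeights.
Variables (R : realType) (G : wgraph R) (p : R).
Variables (mu : {ffun oedge G -> R}) (nu f : {ffun inode G -> R}).
Variables (lam C D : R).
Hypothesis p_gt2 : 2 < p.
Hypothesis C_gt0 : 0 < C.
Hypothesis D_gt0 : 0 < D.
Hypothesis muE : forall e, mu e = C * `|grad f e| `^ (p - 2).
Hypothesis nuE : forall u, nu u = D * `|f u| `^ (p - 2).
Hypothesis f_neq0 : f != 0.
Hypothesis f_rad : forall y, pencil mu nu lam f y = 0.
Hypothesis Mf_gt0 : 0 < mform nu f f.
Let Lam := lam * (D / C).

Lemma kform_rad y : kform mu f y = lam * mform nu f y.
Proof. by apply/eqP; rewrite -subr_eq0; apply/eqP/f_rad. Qed.

Lemma psum_grad : psum p (@grad R G) f = kform mu f f / C.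
Proof.
rewrite /psum /kform /wform mulr_suml; apply: eq_bigr => e _.
rewrite muE norm_powR_split //; field; exact: lt0r_neq0.
Qed.

Lemma psum_id : psum p id f = mform nu f f / D.
Proof.
rewrite /psum /mform /wform mulr_suml; apply: eq_bigr => u _.
rewrite nuE norm_powR_split //; field; exact: lt0r_neq0.
Qed.

Lemma psum1_grad v : psum1 p (@grad R G) f v = p / C * kform mu f v.
Proof.
rewrite /psum1 /kform /wform mulr_sumr; apply: eq_bigr => e _.
rewrite muE; field; exact: lt0r_neq0.
Qed.

Lemma psum1_id v : psum1 p id f v = p / D * mform nu f v.
Proof.
rewrite /psum1 /mform /wform mulr_sumr; apply: eq_bigr => u _.
rewrite nuE; field; exact: lt0r_neq0.
Qed.

Lemma pweight_grad v :
  wform (pweight p (@grad R G) f) (@grad R G) v v =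
  p * (p - 1) / C * kform mu v v.
Proof.
rewrite /kform /wform mulr_sumr; apply: eq_bigr => e _.
rewrite [pweight _ _ _ _]ffunE muE; field; exact: lt0r_neq0.
Qed.

Lemma pweight_id v :
  wform (pweight p id f) id v v = p * (p - 1) / D * mform nu v v.
Proof.
rewrite /mform /wform mulr_sumr; apply: eq_bigr => u _.
rewrite [pweight _ _ _ _]ffunE nuE; field; exact: lt0r_neq0.
Qed.

Lemma matching_eigenpair : plaplacian_eigenpair p Lam f.
Proof.
split=> // u; have C0 : C != 0 by exact: lt0r_neq0.
have : dot (dlt R u) (wlaplacian mu f) = lam * dot (dlt R u) (diag nu f).
  by rewrite dot_wlaplacian dot_diag kform_rad.
have dot_dlt x : dot (dlt R u) x = x u.
  rewrite /dot (bigD1 u) //= big1 => [|v /negPf nev].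
    by rewrite ffunE eqxx mul1r addr0.
  by rewrite ffunE nev mul0r.
rewrite !dot_dlt [diag _ _ _]ffunE nuE /wlaplacian /=.
have -> : diag mu (grad f) = C *: [ffun e => `|grad f e| `^ (p - 2) * grad f e].
  apply/ffunP => e; rewrite [LHS]ffunE muE.
  by rewrite [RHS]ffunE [X in _ *: X]ffunE /GRing.scale /= mulrA.
rewrite linearZ [LHS]ffunE -/(plaplacian p f) /GRing.scale /= => h.
rewrite /Lam; apply: (mulfI C0); rewrite h; field.
exact: C0.
Qed.

Lemma matching_ratio : psum p (@grad R G) f / psum p id f = Lam.
Proof.
rewrite psum_grad psum_id kform_rad /Lam; field.
by rewrite !gt_eqF.
Qed.

(** [lam * (D / C)] is the value of the quotient at [f]; it converts the two Hessian
    weights, [p * (p - 1) / C] times [mu] and [p * (p - 1) / D] times [nu], back into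
    the pencil at [lam]. *)
Lemma matching_hessian (c : R) (v : {ffun inode G -> R}) :
  \sum_i \sum_j v i * hessian (fun g => c * prayleigh p g) f i j * v j =
  c * (D * p * (p - 1) / (C * mform nu f f)) * pencil mu nu lam v v.
Proof.
have bf : psum p id f != 0 by rewrite psum_id mulf_neq0 ?invr_neq0 ?gt_eqF.
rewrite (hessian_ratio_form p_gt2 (@grad_linear R G) c v bf).
  rewrite matching_ratio pweight_grad pweight_id psum_id /Lam /pencil; field.
  by rewrite !gt_eqF.
move=> w; rewrite matching_ratio psum1_grad psum1_id kform_rad /Lam; field.
by rewrite !gt_eqF.
Qed.

End MatchingWeights.

Theorem theorem4p1 (R : realType) (G : wgraph R) (p : R) (k : nat)
  (mu : {ffun oedge G -> R}) (nu f : {ffun inode G -> R})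
  (hp : 2 < p) (hk : (1 <= k)%N)
  (hmu : forall e, 0 <= mu e) (hnu : forall u, 0 <= nu u)
  (hsaddle : differentiable_saddle p k mu nu)
  (hf0 : f != 0)
  (hf : f \in weigenspace mu nu (fine (weigenvalue mu nu k))) :
  [/\ plaplacian_eigenpair p (fine (weigenvalue mu nu k) `^ (p / 2)) f,
      morse_index (prayleigh p) f = (k - 1)%N
    & morse_index (fun g => - prayleigh p g) f = (#|inode G| - k)%N].
Proof.
case: hsaddle => [/andP[lam0 lamy] simple sat_mu sat_nu].
move: hf simple; set lam := fine _ => hf simple.
have lamE : weigenvalue mu nu k = lam%:E.
  by rewrite /lam fineK // fin_real // lamy (lt_trans _ lam0) ?ltNy0.
have lam_gt0 : 0 < lam by move: lam0; rewrite lamE lte_fin.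
have [N [P [Nneg Ppos dimN dimNP dimW]]] :=
  simple_eigenvalue_index hmu hnu hk lam_gt0 lamE simple.
have f_rad y : pencil mu nu lam f y = 0 by move/weigenspaceP: hf; apply.
have Kf y := kform_rad f_rad y.
(* If [M f f = 0], then [f] lies in the common kernel, which is trivial. *)
have Mf_gt0 : 0 < mform nu f f.
  rewrite lt_neqAle wform_ge0 // andbT eq_sym; apply: contraNneq hf0 => Mf0.
  have nuf u : nu u * f u = 0.
    have /eqP : mform nu f f = 0 := Mf0.
    rewrite psumr_eq0 => [|v _]; last by rewrite mulr_ge0 // -expr2 sqr_ge0.
    move=> /allP/(_ u (mem_index_enum u))/eqP h.
    by apply/eqP; move/eqP: h; rewrite mulrA mulf_eq0 => /orP[//|/eqP->]; rewrite mulr0.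
  have Mf y : mform nu f y = 0.
    by apply: big1 => u _; rewrite mulrA nuf mul0r.
  have : f \in common_ker mu nu.
    by apply/common_kerP; split=> y //; rewrite Kf Mf mulr0.
  by move/eqP: dimW; rewrite dimv_eq0 => /eqP->; rewrite memv0.
have Kf_gt0 : 0 < kform mu f f by rewrite Kf mulr_gt0.
have dimN' : (k <= \dim N + 1)%N by rewrite dimN; move: hk; clear; lia.
have dimP : (#|inode G| <= k + \dim P)%N.
  by rewrite -dimNP dimN; move: hk; clear; lia.
pose r := (p - 2) / 2.
pose C := ((lam * kform mu f f) `^ r)^-1.
pose D := (kform mu f f `^ r)^-1.
have C_gt0 : 0 < C by rewrite invr_gt0 powR_gt0 // mulr_gt0.
have D_gt0 : 0 < D by rewrite invr_gt0 powR_gt0.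
have muE e : mu e = C * `|grad f e| `^ (p - 2).
  apply: powR_weight => //; first by rewrite mulr_gt0.
  have [d [hd d0 dmu]] := sat_mu e.
  exact: (saddle_edge_weight hp hmu hnu lam_gt0 lamE f_rad Kf_gt0 Ppos dimP
    hd d0 dmu).
have nuE u : nu u = D * `|f u| `^ (p - 2).
  apply: powR_weight => //.
  have [d [hd d0 dnu]] := sat_nu u.
  exact: (saddle_node_weight hp hk hmu hnu lam_gt0 lamE f_rad Kf_gt0 Nneg
    dimN' hd d0 dnu).
(* [D / C = lam `^ ((p - 2) / 2)]. *)
have LamE : lam * (D / C) = lam `^ (p / 2).
  rewrite /C /D invrK powRM ?ltW // [X in lam * X]mulrC mulfK; last first.
    by rewrite gt_eqF ?powR_gt0.
  rewrite -{1}[lam]powRr1 ?ltW // -powRD; last first.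
    by rewrite (gt_eqF lam_gt0) implybT.
  by congr (_ `^ _); rewrite /r; field.
have kap_gt0 : 0 < D * p * (p - 1) / (C * mform nu f f).
  by rewrite divr_gt0 ?mulr_gt0 //; lra.
have hess := matching_hessian hp C_gt0 D_gt0 muE nuE f_rad Mf_gt0.
have hQ := symform_pencil mu nu lam.
have hNQ := symform_opp hQ.
have f_nrad y : - pencil mu nu lam f y = 0 by rewrite f_rad oppr0.
have dimPf := posdef_dim_line hQ Ppos f_rad hf0.
have dimNf := posdef_dim_line hNQ Nneg f_nrad hf0.
split.
- by rewrite -LamE; apply: (matching_eigenpair C_gt0 muE nuE hf0 f_rad).
- rewrite -dimN (_ : prayleigh p = fun g => 1 * prayleigh p g); last first.
    by apply/funext => g; rewrite mul1r.
  apply: (morse_index_eq (B := pencil mu nu lam) (P := (P + <[f]>)%VS)) => //.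
  + by move=> v; rewrite hess mul1r pmulr_rlt0.
  + exact: (posdef_add_radical hQ Ppos f_rad).
  + by rewrite dimPf -dimNP addnAC addnA.
have -> : (#|inode G| - k)%N = \dim P.
  by rewrite -dimNP dimN; move: hk; clear; lia.
rewrite (_ : (fun g => _) = fun g => -1 * prayleigh p g); last first.
  by apply/funext => g; rewrite mulN1r.
apply: (morse_index_eq (B := fun x y => - pencil mu nu lam x y)
  (P := (N + <[f]>)%VS)) => //.
- by move=> v; rewrite hess mulN1r mulNr oppr_lt0 pmulr_rgt0 // oppr_lt0.
- by move=> v vP v0; rewrite opprK Ppos.
- exact: (posdef_add_radical hNQ Nneg f_nrad).
- by rewrite dimNf -dimNP addnC.
Qed.
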